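(* Let $\alpha\in(0,2)$, $d\ge3$. There exists a constant $C_{d,\alpha}>0$ such that for all $m>0$, $\lambda\ge0$ and $x\in\mathbb{R}^d\setminus\{0\}$, $$R^m_\lambda(x)\le C_{d,\alpha}\left(\frac{1}{|x|^{d-\alpha}}+\frac{m^{\frac2\alpha-1}}{|x|^{d-2}}\right).$$
   Context: For $\alpha\in(0,2)$, $m>0$, $L_{m,\alpha}=(-\Delta+m^{2/\alpha})^{\alpha/2}-m$ on $L^2(\mathbb{R}^d)$ is the operator with Fourier multiplier $(|y|^2+m^{2/\alpha})^{\alpha/2}-m$. $p^m_t(x-y)$ is the integral kernel of $e^{-tL_{m,\alpha}}$, and $R^m_\lambda(x)=\int_0^\infty e^{-\lambda t}p^m_t(x)\,dt$ is the resolvent kernel. *)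

(* Defs.v *)
From HB Require Import structures.
From mathcomp Require Import all_boot all_order all_algebra.
From mathcomp Require Import complex.
From mathcomp Require Import all_classical all_reals all_analysis.

Set Implicit Arguments.
Unset Strict Implicit.
Unset Printing Implicit Defensive.

Import Order.TTheory GRing.Theory Num.Theory.
Import numFieldTopology.Exports numFieldNormedType.Exports.

Local Open Scope classical_set_scope.
Local Open Scope ring_scope.
Local Open Scope complex_scope.

(* R^n is 'rV[R]_n.  Its sigma-algebra is the one generated by the n
   coordinate functions, i.e. the Borel sigma-algebra of the topology that
   the library puts on 'rV[R]_n. *)
Section measurable_rV.
Context (R : realType) (n : nat).

Definition rV_coord (i : 'I_n) (x : 'rV[R]_n) : R := x ord0 i.

Let rV_set0 : g_sigma_preimage rV_coord set0.
Proof. exact: sigma_algebra0. Qed.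

Let rV_setC A : g_sigma_preimage rV_coord A -> g_sigma_preimage rV_coord (~` A).
Proof. exact: sigma_algebraC. Qed.

Let rV_bigcup (F : _^nat) : (forall i, g_sigma_preimage rV_coord (F i)) ->
  g_sigma_preimage rV_coord (\bigcup_i (F i)).
Proof. exact: sigma_algebra_bigcup. Qed.

HB.instance Definition _ := @isMeasurable.Build default_measure_display
  'rV[R]_n (g_sigma_preimage rV_coord) rV_set0 rV_setC rV_bigcup.

Lemma measurable_rV_coord (i : 'I_n) : measurable_fun setT (rV_coord i).
Proof.
move=> _ Y mY; rewrite setTI; apply: sub_sigma_algebra => /=.
rewrite -bigcup_seq/=; exists i => /=; first by rewrite mem_index_enum.
by exists Y => //; rewrite setTI.
Qed.

Lemma measurable_fun_rV d (T : measurableType d) (f : T -> 'rV[R]_n) :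
  (forall i, measurable_fun setT (rV_coord i \o f)) -> measurable_fun setT f.
Proof.
move=> mf _ A; rewrite setTI; move: A.
apply: smallest_sub.
  split=> [|A|F].
  - by rewrite /= preimage_set0.
  - by move=> mA; rewrite setTD preimage_setC; exact: measurableC.
  - by move=> mF; rewrite /= preimage_bigcup; exact: bigcupT_measurable.
rewrite -bigcup_seq/=; apply: bigcup_sub => i _ A [B mB <-].
by rewrite setTI -comp_preimage -[X in measurable X]setTI; exact: mf.
Qed.

End measurable_rV.

(* Lebesgue measure on R^n, by recursion on n: the image of the product of the
   Lebesgue measures on R and R^n under the identification R x R^n = R^n.+1. *)
Section lebesgue_rVS.
Context (R : realType) (n : nat).

Definition rV_cons (p : R * 'rV[R]_n) : 'rV[R]_n.+1 :=
  \row_(i < n.+1) if unlift ord0 i is Some j then p.2 ord0 j else p.1.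

Definition rV_uncons (x : 'rV[R]_n.+1) : R * 'rV[R]_n :=
  (x ord0 ord0, \row_(j < n) x ord0 (lift ord0 j)).

Lemma rV_consK : cancel rV_cons rV_uncons.
Proof.
move=> [a v]; rewrite /rV_uncons; congr pair; first by rewrite mxE unlift_none.
by apply/rowP => j; rewrite !mxE liftK.
Qed.

Lemma measurable_rV_cons : measurable_fun setT rV_cons.
Proof.
apply: measurable_fun_rV => i.
case: (unliftP ord0 i) => [j ->|->].
- rewrite [X in measurable_fun _ X](_ : _ = rV_coord j \o snd).
    by apply: measurableT_comp => //; exact: measurable_rV_coord.
  by apply/funext => p /=; rewrite /rV_coord mxE liftK.
- rewrite [X in measurable_fun _ X](_ : _ = fst)//.
  by apply/funext => p /=; rewrite /rV_coord mxE unlift_none.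
Qed.

Lemma measurable_rV_uncons : measurable_fun setT rV_uncons.
Proof.
apply: measurable_fun_pair; first exact: measurable_rV_coord.
apply: measurable_fun_rV => j.
rewrite [X in measurable_fun _ X](_ : _ = rV_coord (lift ord0 j)).
  exact: measurable_rV_coord.
by apply/funext => x /=; rewrite /rV_coord mxE.
Qed.

Variable mu : {sigma_finite_measure set 'rV[R]_n -> \bar R}.

Definition lebesgue_rVS : set 'rV[R]_n.+1 -> \bar R :=
  pushforward (@lebesgue_measure R \x mu)%E rV_cons.

Let lebesgue_rVS0 : lebesgue_rVS set0 = 0%E.
Proof. by rewrite /lebesgue_rVS /pushforward preimage_set0 measure0. Qed.

Let lebesgue_rVS_ge0 A : (0 <= lebesgue_rVS A)%E.
Proof. by rewrite /lebesgue_rVS /pushforward measure_ge0. Qed.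

Let lebesgue_rVS_sigma_additive : semi_sigma_additive lebesgue_rVS.
Proof.
move=> F mF tF mUF; rewrite /lebesgue_rVS /pushforward preimage_bigcup.
apply: measure_semi_sigma_additive.
- by move=> k; rewrite -[X in measurable X]setTI; exact: measurable_rV_cons.
- apply/trivIsetP => /= i j _ _ ij; rewrite -preimage_setI.
  by move/trivIsetP : tF => /(_ _ _ _ _ ij) ->//; rewrite preimage_set0.
- rewrite -preimage_bigcup -[X in measurable X]setTI.
  exact: measurable_rV_cons.
Qed.

HB.instance Definition _ := isMeasure.Build _ _ _ lebesgue_rVS
  lebesgue_rVS0 lebesgue_rVS_ge0 lebesgue_rVS_sigma_additive.

Let lebesgue_rVS_sigma_finite : sigma_finite setT lebesgue_rVS.
Proof.
have /sigma_finiteP[F [TF ndF Foo]] := sigma_finiteT (@lebesgue_measure R).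
have /sigma_finiteP[G [TG ndG Goo]] := sigma_finiteT mu.
exists (fun k => rV_uncons @^-1` (F k `*` G k)).
  rewrite -preimage_bigcup (_ : \bigcup_k _ = setT) ?preimage_setT//.
  apply/seteqP; split=> // -[a v] _.
  have [i _ Fia] : (\bigcup_i F i) a by rewrite -TF.
  have [j _ Gjv] : (\bigcup_i G i) v by rewrite -TG.
  exists (maxn i j) => //; split=> /=.
  - by move: a Fia; exact/subsetPset/ndF/leq_maxl.
  - by move: v Gjv; exact/subsetPset/ndG/leq_maxr.
move=> k; have [mF Fk] := Foo k; have [mG Gk] := Goo k; split.
  rewrite -[X in measurable X]setTI.
  by apply: measurable_rV_uncons => //; exact: measurableX.
rewrite /lebesgue_rVS /pushforward -comp_preimage.
rewrite (_ : rV_uncons \o rV_cons = id); last first.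
  by apply/funext => p; exact: rV_consK.
rewrite preimage_id product_measure1E//.
by rewrite lte_mul_pinfty// ge0_fin_numE.
Qed.

HB.instance Definition _ := Measure_isSigmaFinite.Build _ _ _ lebesgue_rVS
  lebesgue_rVS_sigma_finite.

End lebesgue_rVS.

Fixpoint lebesgue_rV (R : realType) (n : nat) :
    {sigma_finite_measure set 'rV[R]_n -> \bar R} :=
  match n with
  | 0 => [the {sigma_finite_measure set 'rV[R]_0 -> \bar R} of
           \d_(0 : 'rV[R]_0)]
  | k.+1 => [the {sigma_finite_measure set 'rV[R]_k.+1 -> \bar R} of
              lebesgue_rVS (lebesgue_rV R k)]
  end.

Section relativistic_stable.
Context (R : realType) (d : nat).
Implicit Types (alpha m t lambda : R) (x y xi : 'rV[R]_d)
  (f g : 'rV[R]_d -> R[i]) (p : R -> 'rV[R]_d -> R).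

Local Notation leb := (lebesgue_rV R d).

Definition dotv x y : R := \sum_(i < d) x ord0 i * y ord0 i.

(* The Euclidean norm; the library's norm on 'rV[R]_d is the sup norm. *)
Definition enorm x : R := Num.sqrt (dotv x x).

Definition expi (a : R) : R[i] := cos a +i* sin a.

Definition cintegrable f : Prop :=
  leb.-integrable setT (fun x => (complex.Re (f x))%:E) /\
  leb.-integrable setT (fun x => (complex.Im (f x))%:E).

Definition cintegral f : R[i] :=
  (\int[leb]_x complex.Re (f x)) +i* (\int[leb]_x complex.Im (f x)).

Definition in_Lp (q : \bar R) f : Prop :=
  (fun x => complex.Re (f x)) \in Lfun leb q /\
  (fun x => complex.Im (f x)) \in Lfun leb q.

Definition fourier f xi : R[i] :=
  cintegral (fun x => expi (- dotv xi x) * f x).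

Definition inv_fourier g x : R[i] :=
  ((2 * pi) ^- d)%:C * cintegral (fun xi => expi (dotv x xi) * g xi).

(* The Fourier multiplier of L_{m,alpha}. *)
Definition symbolL alpha m xi : R :=
  (enorm xi ^+ 2 + m `^ (2 / alpha)) `^ (alpha / 2) - m.

(* The operator exp(- t L_{m,alpha}), i.e. the one with Fourier multiplier
   exp (- t * symbolL alpha m), for t > 0.  The formula is meant for f in
   L^1 and L^2: then the transform of f is bounded and square integrable, its
   product with the multiplier is integrable, so both integrals converge and
   agree with the Plancherel transforms.  As this class is dense in L^2, the
   bounded operator is determined by these values. *)
Definition semigroupL alpha m t f : 'rV[R]_d -> R[i] :=
  inv_fourier (fun xi => (expR (- (t * symbolL alpha m xi)))%:C * fourier f xi).

(* p t (x - y) is the integral kernel of exp(- t L_{m,alpha}) for t > 0.  An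
   integral kernel is unique only up to null sets; continuity of p t selects
   the version for which pointwise values make sense. *)
Definition is_heat_kernel alpha m p : Prop :=
  forall t, 0 < t ->
    continuous (p t) /\
    forall f, in_Lp 1%E f -> in_Lp 2%:E f ->
      \forall x \ae leb,
        cintegrable (fun y => (p t (x - y))%:C * f y) /\
        semigroupL alpha m t f x = cintegral (fun y => (p t (x - y))%:C * f y).

Definition resolvent_kernel p lambda x : \bar R :=
  (\int[@lebesgue_measure R]_(t in `]0%R, +oo[)
     (expR (- (lambda * t)) * p t x)%:E)%E.

End relativistic_stable.

(* Main.v *)
Require Import Defs.
From HB Require Import structures.
From mathcomp Require Import all_boot all_order all_algebra.
From mathcomp Require Import complex.
From mathcomp Require Import all_classical all_reals all_analysis.
From mathcomp Require Import measurable_realfun ring lra.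

Set Implicit Arguments.
Unset Strict Implicit.
Unset Printing Implicit Defensive.

Import Order.TTheory GRing.Theory Num.Theory.
Import numFieldTopology.Exports numFieldNormedType.Exports.

Local Open Scope classical_set_scope.
Local Open Scope ring_scope.

(* Let psi(q) = (q + m^(2/alpha))^(alpha/2) - m, so that the multiplier of
   exp(-tL) is F_t(xi) = exp(- t psi(|xi|^2)).  As psi is a Bernstein function,
   q |-> exp(- t psi(q)) is a limit of positive combinations of the
   exponentials exp(- u q), and for a single exponential the explicit Gaussian
   transform gives, with n the dimension,
     int F(xi) cos(z . xi) dxi <= int F(xi) exp(- |z|^2 |xi|^2 / (2 n)) dxi.
   This inequality is linear in F and survives the limit, hence holds for F_t:
   it bounds p_t(x) by (2 pi)^(-n) int F_t(xi) exp(- |x|^2 |xi|^2 / (8 n)) dxi.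
   The bound is nonnegative, so lambda can be dropped, and Tonelli turns the
   time integral into 1 / psi(|xi|^2), which is at most
   (2 / alpha) (|xi|^(-alpha) + m^(2/alpha - 1) |xi|^(-2)).  Finally
   |xi|^(-a) <= prod_j |xi_j|^(-a/n) splits the integral into one-dimensional
   ones, finite because a < n; scaling gives the powers of |x|. *)

(** * Completely monotone and Bernstein functions *)

(** The obstacle is the oscillation of the cosine. The function [1 / psi(|xi|^2)] decays only like
    [|xi|^(-alpha)], with [alpha < 2 < n], so it is not integrable at infinity, and bounding the
    cosine by 1 before integrating in time would lose everything. Trading the cosine for a Gaussian
    first, with cutoff at [|xi|] of order [1 / |x|], makes all integrands nonnegative, so that
    Tonelli applies, and it is the only source of decay in [|x|]. Proving this trade as an
    inequality stable under limits replaces the law of the subordinator, which never has to be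
    constructed. The two terms of the bound are the two regimes of [psi]: it grows like
    [q^(alpha/2)] for large [q] and behaves like [(alpha/2) m^(1 - 2/alpha) q] near 0. The second
    regime produces the singularity [|xi|^(-2)], whose share [2/n] per coordinate must be below 1;
    this is where dimension at least 3 enters. The constant [8 n] instead of [2 n] is the price of
    knowing the kernel only through averages: they involve points [z] near [x], for which
    [|z|^2 >= |x|^2 / 4] is used. *)

Section completely_monotone.
Context {R : realType}.
Implicit Types (f g : R -> R) (r s t u c delta beta : R).

(* By Bernstein's theorem these are, on ]0, +oo[, bounded completely monotone
   functions; taking the closure as the definition avoids that theorem, and
   every linear statement about them reduces to exponentials. *)
Inductive cmono : (R -> R) -> Prop :=
| cmono_expN u of 0 <= u : cmono (fun s => expR (- (u * s)))
| cmonoD f g of cmono f & cmono g : cmono (fun s => f s + g s)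
| cmonoZ c f of 0 <= c & cmono f : cmono (fun s => c * f s)
| cmono_lim (f_ : nat -> R -> R) g of (forall n, cmono (f_ n)) &
    (forall s, 0 <= s -> f_ n s @[n --> \oo] --> g s) : cmono g.

Lemma eq_cmono f g : (forall s, 0 <= s -> f s = g s) -> cmono f -> cmono g.
Proof.
move=> fg cf; apply: (@cmono_lim (fun=> f)) => // s s0.
by rewrite fg//; exact: cvg_cst.
Qed.

(** The value at 0 is the uniform bound behind dominated convergence: if [f_ n 0] converges, it is
    bounded, and a bound for it dominates every [f_ n] on the whole half-line. *)
Lemma cmono_bounds f s : cmono f -> 0 <= s -> 0 <= f s <= f 0.
Proof.
move=> cf; elim: cf s => {f}[u u0|f g _ IHf _ IHg|c f c0 _ IHf|f_ g _ IH fg] s s0.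
- by rewrite expR_ge0 ler_expR mulr0 oppr0 oppr_le0 mulr_ge0.
- by have := IHf _ s0; have := IHg _ s0; lra.
- by have /andP[? ?] := IHf _ s0; rewrite mulr_ge0//= ler_wpM2l.
- apply/andP; split.
    apply: (ler_cvg_to (cvg_cst 0) (fg s s0)); apply: nearW => n.
    by have /andP[] := IH n _ s0.
  apply: (ler_cvg_to (fg s s0) (fg 0 (lexx _))); apply: nearW => n.
  by have /andP[] := IH n _ s0.
Qed.

Lemma cmono_ge0 f s : cmono f -> 0 <= s -> 0 <= f s.
Proof. by move=> cf /(cmono_bounds cf)/andP[]. Qed.

Lemma cmono_measurable f : cmono f -> measurable_fun (`[0, +oo[%classic : set R) f.
Proof.
elim=> {f}[u u0|f g _ mf _ mg|c f c0 _ mf|f_ g _ mf fg].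
- by apply: measurable_funTS; apply: measurableT_comp => //; exact: measurableT_comp.
- exact: measurable_funD.
- exact: measurable_funM.
- apply: (measurable_fun_cvg mf) => s /=; rewrite in_itv/= andbT; exact: fg.
Qed.

Lemma cmonoM f g : cmono f -> cmono g -> cmono (fun s => f s * g s).
Proof.
move=> cf cg; elim: cf => {f}[u u0|f1 f2 _ IH1 _ IH2|c f c0 _ IH|f_ f _ IH ff].
- elim: cg => {g}[v v0|g1 g2 _ IH1 _ IH2|c g c0 _ IH|g_ g _ IH gg].
  + apply: (@eq_cmono (fun s => expR (- ((u + v) * s)))).
      by move=> s _; rewrite -expRD; congr expR; ring.
    by apply: cmono_expN; exact: addr_ge0.
  + by apply: (eq_cmono _ (cmonoD IH1 IH2)) => s _; rewrite mulrDr.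
  + by apply: (eq_cmono _ (cmonoZ c0 IH)) => s _; rewrite mulrCA.
  + by apply: (cmono_lim IH) => s s0; apply: cvgMr; exact: gg.
- by apply: (eq_cmono _ (cmonoD IH1 IH2)) => s _; rewrite mulrDl.
- by apply: (eq_cmono _ (cmonoZ c0 IH)) => s _; rewrite mulrA.
- by apply: (cmono_lim IH) => s s0; apply: cvgMl; exact: ff.
Qed.

Lemma cmono_cst c : 0 <= c -> cmono (fun=> c).
Proof.
move=> c0; apply: (eq_cmono _ (cmonoZ c0 (cmono_expN (lexx 0)))) => s _.
by rewrite mul0r oppr0 expR0 mulr1.
Qed.

Lemma cmono_power_series f (a_ : nat -> R) n : (forall k, 0 <= a_ k) -> cmono f ->
  cmono (fun s => \sum_(0 <= k < n) a_ k * f s ^+ k).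
Proof.
move=> a0 cf; elim: n => [|n IH].
  by apply: (eq_cmono _ (cmono_cst (lexx 0))) => s _; rewrite big_geq.
apply: (@eq_cmono (fun s => \sum_(0 <= k < n) a_ k * f s ^+ k + a_ n * f s ^+ n)).
  by move=> s _; rewrite big_nat_recr.
apply: cmonoD => //; apply: cmonoZ => //.
elim: n {IH} => [|n IH]; first by apply: (eq_cmono _ (cmono_cst ler01)).
by apply: (eq_cmono _ (cmonoM cf IH)) => s _; rewrite exprS.
Qed.

(** The coefficients of the exponential series are nonnegative, so its partial sums stay in the
    class. *)
Lemma cmono_expR f : cmono f -> cmono (fun s => expR (f s)).
Proof.
move=> cf; apply: (@cmono_lim (fun n s => \sum_(0 <= k < n) (k`!%:R)^-1 * f s ^+ k)).
  by move=> n; apply: cmono_power_series => // k; rewrite invr_ge0.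
move=> s _; have := is_cvg_series_exp_coeff (f s).
by rewrite exp_coeffE => h; rewrite /expR exp_coeffE; exact: h.
Qed.

(* [h / (1 - exp (- h (s + delta)))], a geometric series in [exp (- h s)], tends
   to [1 / (s + delta)] as [h] tends to 0. *)
Lemma cmono_inv delta : 0 < delta -> cmono (fun s => (s + delta)^-1).
Proof.
move=> d0; pose h n : R := n.+1%:R^-1.
apply: (@cmono_lim (fun n s => h n * (1 - expR (- (h n * (s + delta))))^-1)).
  move=> n; have hn0 : 0 < h n by rewrite invr_gt0.
  apply: cmonoZ; first exact: ltW.
  pose z s := expR (- (h n * delta)) * expR (- (h n * s)).
  have zE s : z s = expR (- (h n * (s + delta))) by rewrite /z -expRD; congr expR; ring.
  apply: (@cmono_lim (fun m s => \sum_(0 <= k < m) 1 * z s ^+ k)).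
    move=> m; apply: (@cmono_power_series z) => //.
    by apply: cmonoZ; [exact: expR_ge0|apply: cmono_expN; exact: ltW].
  move=> s s0; rewrite -zE -[_^-1]mul1r; apply: cvg_geometric_series.
  rewrite zE ger0_norm ?expR_ge0// -expR0 ltr_expR oppr_lt0.
  by rewrite mulr_gt0// ltr_wpDl.
move=> s s0; set v := s + delta; have v0 : 0 < v by rewrite /v ltr_wpDl.
move: v v0 => {s s0} v v0.
(* From [1 - h v <= exp(- h v) <= 1 / (1 + h v)] the quotient [h / (1 - exp(- h v))] lies between
   [1 / v] and [1 / v + h]. *)
apply: (@squeeze_cvgr _ _ _ _ (fun=> v^-1) (fun n => v^-1 + h n)).
- apply: nearW => n; have hn0 : 0 < h n by rewrite invr_gt0.
  have hv : 0 < h n * v by rewrite mulr_gt0.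
  have e1 : expR (- (h n * v)) <= (1 + h n * v)^-1.
    by rewrite expRN lef_pV2 ?posrE ?expR_gt0 ?addr_gt0// expR_ge1Dx.
  have e2 := expR_ge1Dx (- (h n * v)).
  have e4 : (1 + h n * v)^-1 = 1 - h n * v / (1 + h n * v).
    by field; rewrite gt_eqF// addr_gt0.
  have q0 : 0 < h n * v / (1 + h n * v) by rewrite divr_gt0// addr_gt0.
  have e3 : 0 < 1 - expR (- (h n * v)) by lra.
  apply/andP; split.
    by rewrite ler_pdivlMr// mulrC ler_pdivrMr//; lra.
  rewrite ler_pdivrMr//.
  have -> : v^-1 + h n = (1 + h n * v) / v by field; rewrite gt_eqF.
  rewrite -ler_pdivrMl ?divr_gt0 ?addr_gt0//.
  have -> : ((1 + h n * v) / v)^-1 * h n = h n * v / (1 + h n * v).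
    by field; rewrite !gt_eqF// addr_gt0.
  by lra.
- exact: cvg_cst.
- rewrite -[X in _ --> X]addr0; apply: cvgD; first exact: cvg_cst.
  exact: cvg_harmonic.
Qed.


(** This is Schoenberg's characterisation, up to an additive constant, in place of the usual
    definition by a completely monotone derivative. It is exactly the property that the multiplier
    has to have. *)
Definition bernstein f := forall t, 0 <= t -> cmono (fun s => expR (- (t * f s))).

Local Notation leb := (@lebesgue_measure R).

Lemma continuous_FTC2_ge0 f (F : R -> R) s : 0 <= s ->
  (forall r, 0 <= r -> derivable F r 1 /\ 'D_1 F r = f r) ->
  (forall r, 0 <= r -> {for r, continuous f}) ->
  \int[leb]_(r in `[0, s]) f r = F s - F 0.
Proof.
rewrite le_eqVlt => /predU1P[<- _ _|s0 dF cf].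
  by rewrite set_itv1 Rintegral_set1 subrr.
have cF r : 0 <= r -> {for r, continuous F}.
  by move=> /dF[dFr _]; exact/differentiable_continuous/derivable1_diffP.
rewrite /Rintegral (@continuous_FTC2 _ f F)//.
- apply: continuous_in_subspaceT => r /[!inE]/=; rewrite in_itv/= => /andP[r0 _].
  exact: cf.
- split.
  + by move=> r; rewrite in_itv/= => /andP[/ltW/dF[]].
  + by apply: cvg_at_right_filter; exact: cF.
  + by apply: cvg_at_left_filter; exact/cF/ltW.
- move=> r; rewrite in_itv/= => /andP[/ltW/dF[_ <-] _].
  by rewrite derive1E.
Qed.

Lemma is_derive_pair (F : R -> R) (x dF : R) : is_derive x 1 F dF ->
  derivable F x 1 /\ 'D_1 F x = dF.
Proof. by case. Qed.

Lemma cmono_integrable_itv f s : cmono f -> leb.-integrable `[0, s] (EFin \o f).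
Proof.
move=> cf; apply: measurable_bounded_integrable => //.
- by rewrite /= lebesgue_measure_itv/=; case: ifPn => _; rewrite ?ltry.
- apply: (measurable_funS _ _ (cmono_measurable cf)) => //.
  by move=> r /=; rewrite !in_itv/= => /andP[->].
exists (f 0); split; first exact: num_real.
move=> M f0M r /=; rewrite in_itv/= => /andP[r0 _].
by have /andP[f0 fr] := cmono_bounds cf r0; rewrite ger0_norm// (le_trans fr)// ltW.
Qed.

(** For [exp(- u r)] the primitive is [(1 - exp(- u s)) / u], and [exp(- t (1 - exp(- u s)) / u)]
    equals [exp(- t/u)] times the exponential of the completely monotone function
    [(t/u) exp(- u s)]. Sums of [f] become products, a factor [c] is absorbed into [t], and limits
    pass by dominated convergence on [[0, s]]. *)
Lemma bernstein_integral f : cmono f ->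
  bernstein (fun s => \int[leb]_(r in `[0, s]) f r).
Proof.
elim=> {f}[u u0|f g cf IHf cg IHg|c f c0 cf IH|f_ f cf IH ff] t t0.
- move: u0; rewrite le_eqVlt => /predU1P[<-|u0].
    apply: (@eq_cmono (fun s => expR (- (t * s)))); last exact: cmono_expN.
    move=> s s0; rewrite (@continuous_FTC2_ge0 _ id) ?subr0//.
    + by move=> r _; rewrite mul0r oppr0 expR0 derive_id; split=> //; exact: derivable_id.
    + move=> r _ /=.
      rewrite (_ : (fun _ => _) = cst 1); first exact: cst_continuous.
      by apply/funext => x; rewrite mul0r oppr0 expR0.
  have tu0 : 0 <= t / u by rewrite divr_ge0// ltW.
  have := cmonoM (cmono_cst (expR_ge0 (- (t / u))))
    (cmono_expR (cmonoZ tu0 (cmono_expN (ltW u0)))).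
  apply: eq_cmono => s s0.
  rewrite (@continuous_FTC2_ge0 _ (fun r => - u^-1 * expR (- (u * r))))//.
  + by rewrite mulr0 oppr0 expR0 -expRD; congr expR; field; rewrite gt_eqF.
  + move=> r _; apply: is_derive_pair; apply: is_derive_eq.
    by rewrite /GRing.scale/=; field; rewrite gt_eqF.
  + move=> r _; apply: (@continuous_comp _ _ _ (fun r => - (u * r)) expR).
      by apply: cvgN; apply: cvgMr; exact: cvg_id.
    exact: continuous_expR.
- apply: (eq_cmono _ (cmonoM (IHf t t0) (IHg t t0))) => s s0.
  rewrite -expRD RintegralD//; [|exact: cmono_integrable_itv..].
  by congr expR; ring.
- have /IH : 0 <= t * c by rewrite mulr_ge0.
  apply: eq_cmono => s s0; rewrite RintegralZl//; last exact: cmono_integrable_itv.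
  by rewrite mulrA.
- apply: (cmono_lim (fun n => IH n t t0)) => s s0.
  apply: (@continuous_cvg _ _ _ _ _ _ expR); first exact: continuous_expR.
  apply: cvgN; apply: cvgMr; apply: fine_cvg.
  have cvgf0 : cvgn (fun n => f_ n 0) by apply/cvg_ex; exists (f 0); exact: ff.
  have [M [_ /(_ (M + 1))]] := cvg_seq_bounded cvgf0.
  rewrite ltrDl ltr01 => /(_ isT) fM.
  have icst : leb.-integrable `[0, s] (cst (M + 1)%:E).
    by apply: (cmono_integrable_itv s (cmono_cst _)); exact: le_trans (fM 0%N I).
  have [] := @dominated_convergence _ _ _ leb `[0, s] _
    (fun n r => (f_ n r)%:E) (EFin \o f) (cst (M + 1)%:E) => //.
  + by move=> n; have /measurable_int := cmono_integrable_itv s (cf n).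
  + by apply: measurable_int (cmono_integrable_itv s (cmono_lim cf ff)).
  + apply/aeW => r /=; rewrite in_itv/= => /andP[r0 _].
    by apply: cvg_EFin; [exact: nearW|exact: ff].
  + apply/aeW => r n /=; rewrite in_itv/= => /andP[r0 _]; rewrite lee_fin.
    have /andP[fr0 frf0] := cmono_bounds (cf n) r0.
    rewrite ger0_norm// (le_trans frf0)// (le_trans (ler_norm _))//.
    exact: fM.
  + by move=> ? _; rewrite /Rintegral fineK//; exact: integrable_fin_num.
Qed.

(** The logarithm [ln (s + delta) - ln delta] is the primitive of [1 / (r + delta)], hence
    Bernstein; taking [gamma] as the time parameter turns its exponential into the power. *)
Lemma cmono_powRN delta gamma : 0 < delta -> 0 <= gamma ->
  cmono (fun s => (s + delta) `^ (- gamma)).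
Proof.
move=> d0 g0.
have := cmonoZ (powR_ge0 delta (- gamma)) (bernstein_integral (cmono_inv d0) g0).
apply: eq_cmono => s s0; have sd0 r : 0 <= r -> 0 < r + delta by move=> r0; rewrite ltr_wpDl.
rewrite (@continuous_FTC2_ge0 _ (fun r => ln (r + delta)))//.
- rewrite add0r /powR !gt_eqF ?sd0// -expRD; congr expR; ring.
- move=> r /sd0 rd0; apply: is_derive_pair.
  rewrite -[X in is_derive _ _ _ X]mulr1.
  apply: (@is_derive1_comp _ (@ln R) (fun r => r + delta)).
    exact: is_derive1_ln.
  by apply: is_derive_eq; rewrite addr0.
- move=> r /sd0 rd0; apply: cvgV; first by rewrite gt_eqF.
  by apply: cvgD; [exact: cvg_id|exact: cvg_cst].
Qed.

(** The derivative [beta (r + delta)^(beta - 1)] is completely monotone because [beta - 1] is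
    negative. With [delta = m^(2/alpha)] and [beta = alpha/2] this is the symbol as a function of
    [|xi|^2]. *)
Lemma bernstein_powR delta beta : 0 < delta -> 0 < beta < 1 ->
  bernstein (fun s => (s + delta) `^ beta - delta `^ beta).
Proof.
move=> d0 /andP[b0 b1].
have b1' : 0 <= 1 - beta by rewrite subr_ge0 ltW.
move=> t t0; have := bernstein_integral (cmonoZ (ltW b0) (cmono_powRN d0 b1')) t0.
apply: eq_cmono => s s0; have sd0 r : 0 <= r -> 0 < r + delta by move=> r0; rewrite ltr_wpDl.
rewrite (@continuous_FTC2_ge0 _ (fun r => (r + delta) `^ beta))//.
- by rewrite add0r.
- move=> r /sd0 rd0; apply: is_derive_pair.
  rewrite -[X in is_derive _ _ _ X]mulr1 opprB.
  apply: (@is_derive1_comp _ (@powR R ^~ beta) (fun r => r + delta)).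
    exact: is_derive1_powR.
  by apply: is_derive_eq; rewrite addr0.
- move=> r /sd0 rd0; apply: cvgMr.
  apply: (@continuous_comp _ _ _ (fun r => r + delta) (@powR R ^~ _)).
    by apply: cvgD; [exact: cvg_id|exact: cvg_cst].
  apply/differentiable_continuous/derivable1_diffP.
  by apply: ex_derive; exact: is_derive1_powR.
Qed.

End completely_monotone.

(** * Integration on row vectors *)

Section lebesgue_rV_integral.
Context {R : realType}.
Local Notation leb := (@lebesgue_measure R).
Local Open Scope ereal_scope.

Let measurable_fun_rV_cons n (f : 'rV[R]_n.+1 -> \bar R) :
  measurable_fun setT f ->
  measurable_fun [set: g_sigma_algebraType (R.-ocitv.-measurable) * 'rV[R]_n]
    (f \o @rV_cons R n).
Proof.
move=> mf _ B mB; rewrite setTI comp_preimage -[X in measurable X]setTI.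
apply: measurable_rV_cons => //; rewrite -[X in measurable X]setTI; exact: mf.
Qed.

Lemma ge0_integral_rVS n (f : 'rV[R]_n.+1 -> \bar R) :
  measurable_fun setT f -> (forall x, 0 <= f x) ->
  \int[lebesgue_rV R n.+1]_x f x =
  \int[leb]_a \int[lebesgue_rV R n]_v f (rV_cons (a, v)).
Proof.
move=> mf f0; pose m := [the {measure set _ -> \bar R} of leb \x lebesgue_rV R n].
transitivity (\int[m]_p (f \o @rV_cons R n) p).
  rewrite -(preimage_setT (@rV_cons R n)).
  by rewrite -ge0_integral_pushforward//; exact: measurable_rV_cons.
by rewrite fubini_tonelli1//; [exact: measurable_fun_rV_cons|move=> p; exact: f0].
Qed.

Lemma integral_rVS n (f : 'rV[R]_n.+1 -> \bar R) :
  (lebesgue_rV R n.+1).-integrable setT f ->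
  \int[lebesgue_rV R n.+1]_x f x =
  \int[leb]_a \int[lebesgue_rV R n]_v f (rV_cons (a, v)).
Proof.
move=> intf; have mf : measurable_fun setT f by move/measurable_int: intf.
pose m := [the {measure set _ -> \bar R} of leb \x lebesgue_rV R n].
have intfc : m.-integrable setT (f \o @rV_cons R n).
  apply/integrableP; split.
    exact: measurable_fun_rV_cons.
  move/integrableP : intf => [_]; rewrite ge0_integral_rVS; last 2 first.
  - exact: measurableT_comp.
  - by move=> x; exact: abse_ge0.
  apply: le_lt_trans; rewrite le_eqVlt; apply/orP; left; apply/eqP.
  apply: fubini_tonelli1 => [|p]; last exact: abse_ge0.
  apply: (@measurable_fun_rV_cons _ (fun x => `|f x|)).
  exact: measurableT_comp.
transitivity (\int[m]_p (f \o @rV_cons R n) p).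
  rewrite -(preimage_setT (@rV_cons R n)).
  rewrite -integral_pushforward ?preimage_setT//; exact: measurable_rV_cons.
by rewrite -integral12_prod_meas1.
Qed.

Lemma measurable_fun_prode d (T : measurableType d) n (h : 'I_n -> T -> \bar R) :
  (forall i, measurable_fun setT (h i)) ->
  measurable_fun setT (fun x => \prod_(i < n) h i x).
Proof.
elim: n h => [|n IH] h mh.
  by under eq_fun do rewrite big_ord0; exact: measurable_cst.
under eq_fun do rewrite big_ord_recl; apply: emeasurable_funM => //.
exact: IH.
Qed.

Lemma ge0_integral_rV_prod n (g : 'I_n -> R -> \bar R) :
  (forall i, measurable_fun setT (g i)) -> (forall i a, 0 <= g i a) ->
  \int[lebesgue_rV R n]_x \prod_(i < n) g i (x ord0 i) =
  \prod_(i < n) \int[leb]_a g i a.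
Proof.
elim: n g => [|n IH] g mg g0.
  rewrite big_ord0; under eq_integral do rewrite big_ord0.
  by rewrite integral_dirac// diracT mule1.
have prod_ge0 m (h : 'I_m -> \bar R) : (forall i, 0 <= h i) -> 0 <= \prod_(i < m) h i.
  by move=> h0; apply: (big_ind (fun x => 0 <= x)) => // x y; exact: mule_ge0.
have mgc i (j : 'I_i) (h : R -> \bar R) : measurable_fun setT h ->
    measurable_fun setT (fun x : 'rV[R]_i => h (x ord0 j)).
  by move=> mh; apply: (measurableT_comp mh); exact: measurable_rV_coord.
rewrite ge0_integral_rVS; last 2 first.
- by apply: measurable_fun_prode => i; exact: mgc.
- by move=> x; exact: prod_ge0.
rewrite big_ord_recl -ge0_integralZr//; last first.
  by apply: prod_ge0 => i; exact: integral_ge0.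
  exact: mg.
apply: eq_integral => a _; rewrite -IH//.
rewrite -ge0_integralZl//; last 2 first.
- by apply: measurable_fun_prode => i; exact: mgc.
- by move=> x _; exact: prod_ge0.
apply: eq_integral => v _; rewrite big_ord_recl /= mxE unlift_none; congr (_ * _).
by apply: eq_bigr => i _; rewrite mxE liftK.
Qed.

End lebesgue_rV_integral.

(** * Fourier transform of Gaussians *)

Section gauss_fourier.
Context {R : realType}.
Implicit Types (u v w x z theta : R).
Local Notation leb := (@lebesgue_measure R).

Lemma integral_gauss u : 0 < u ->
  (\int[leb]_x (expR (- (u * x ^+ 2)))%:E = (Num.sqrt (pi / u))%:E)%E.
Proof.
(* [s] is the standard deviation whose normal density is proportional to the integrand, so the value
   is read off from the normalisation. *)
move=> u0; pose s : R := Num.sqrt (2 * u)^-1.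
have s2 : s ^+ 2 = (2 * u)^-1 by rewrite sqr_sqrtr// invr_ge0 mulr_ge0// ltW.
have s0 : s != 0 by rewrite gt_eqF// sqrtr_gt0 invr_gt0 mulr_gt0.
have sq0 : 0 < Num.sqrt (pi / u) by rewrite sqrtr_gt0 divr_gt0// pi_gt0.
have pdfE x : expR (- (u * x ^+ 2)) = Num.sqrt (pi / u) * normal_pdf 0 s x.
  rewrite normal_pdfE// /normal_peak /normal_fun s2 subr0.
  have -> : (2 * u)^-1 * pi *+ 2 = pi / u by rewrite -mulr_natl; field; rewrite gt_eqF.
  rewrite mulVKf ?gt_eqF//; congr expR; rewrite -mulr_natl.
  by field; rewrite gt_eqF.
under eq_integral do rewrite pdfE EFinM.
by rewrite integralZl//= ?integral_normal_pdf ?mule1//; exact: integrable_normal_pdf.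
Qed.

Lemma measurable_gauss u : measurable_fun setT (fun x => expR (- (u * x ^+ 2))).
Proof. by do 2 apply: measurableT_comp => //; apply: measurable_funM. Qed.

Lemma integrable_gauss u : 0 < u ->
  leb.-integrable setT (fun x => (expR (- (u * x ^+ 2)))%:E).
Proof.
move=> u0; apply/integrableP; split.
  by apply/measurable_EFinP; exact: measurable_gauss.
under eq_integral do rewrite gee0_abs ?lee_fin ?expR_ge0//.
by rewrite integral_gauss// ltry.
Qed.

(** Half of the exponent is spent on the factor [|x|], through [|x| <= (1 + 1/u) (1 + u x^2 / 2) <=
    (1 + 1/u) exp(u x^2 / 2)]. The result dominates the derivative in the frequency variable in
    [integral_gauss_cos]. *)
Lemma integrable_gauss_id u : 0 < u ->
  leb.-integrable setT (fun x => (`|x| * expR (- (u * x ^+ 2)))%:E).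
Proof.
move=> u0; have u20 : 0 < u / 2 by rewrite divr_gt0.
apply: le_integrable (integrableZl _ (1 + u^-1) (integrable_gauss u20)) => //.
  by apply/measurable_EFinP; apply: measurable_funM => //; exact: measurable_gauss.
move=> x _; rewrite -EFinM lee_fin [leLHS]normrM normr_id (ger0_norm (expR_ge0 _)).
rewrite [leRHS]ger0_norm; last first.
  by rewrite mulr_ge0 ?expR_ge0// addr_ge0// invr_ge0 ltW.
have -> : - (u * x ^+ 2) = - (u / 2 * x ^+ 2) - u / 2 * x ^+ 2 by field.
rewrite expRD mulrCA [leRHS]mulrC ler_wpM2l ?expR_ge0// expRN ler_pdivrMr ?expR_gt0//.
apply: (@le_trans _ _ ((1 + u^-1) * (1 + u / 2 * x ^+ 2))); last first.
  by rewrite ler_wpM2l ?expR_ge1Dx// addr_ge0// invr_ge0 ltW.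
have -> : (1 + u^-1) * (1 + u / 2 * x ^+ 2) =
    1 + x ^+ 2 / 2 + (u^-1 + u / 2 * x ^+ 2) by field; rewrite gt_eqF.
have h : 0 <= u^-1 + u / 2 * x ^+ 2.
  by rewrite addr_ge0 ?invr_ge0 ?(ltW u0)// mulr_ge0 ?sqr_ge0// ltW.
have : 0 <= (`|x| - 1) ^+ 2 by rewrite sqr_ge0.
by rewrite sqrrB1 -normrX ger0_norm ?sqr_ge0// => h2; nra.
Qed.

(** This serves as integration by parts on the whole line: the boundary terms need to vanish only
    along the integers, since the intervals [A n] already exhaust the line. *)
Lemma integral_derivative_eq0 (h dh : R -> R) :
  (forall x, is_derive x 1 h (dh x)) -> continuous dh ->
  leb.-integrable setT (EFin \o dh) ->
  h n%:R @[n --> \oo] --> (0 : R) -> h (- n%:R) @[n --> \oo] --> (0 : R) ->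
  \int[leb]_x dh x = 0.
Proof.
move=> hdh cdh idh hy hNy.
have ch : continuous h.
  move=> x; apply/differentiable_continuous/derivable1_diffP.
  by case: (hdh x).
pose A n : set R := `[- n.+1%:R, n.+1%:R]%classic.
have mA n : measurable (A n) by exact: measurable_itv.
have lim1 : \int[leb]_(x in A n) dh x @[n --> \oo] --> \int[leb]_x dh x.
  apply: fine_cvg.
  have [] := @dominated_convergence _ _ _ leb setT measurableT
    (fun n => ((EFin \o dh) \_ (A n))) (EFin \o dh) (abse \o (EFin \o dh)).
  - move=> n; apply/(measurable_restrictT _ _).1; first exact: mA.
    by apply: measurable_funTS; move/measurable_int: idh.
  - by move/measurable_int: idh.
  - apply/aeW => x _; apply: cvg_near_cst; near=> n.
    rewrite patchE mem_set// /A/= in_itv/= -ler_norml.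
    near: n; exists (Num.truncn `|x|) => // n /= xn.
    by rewrite (le_trans (ltW (truncnS_gt _)))// ler_nat ltnS.
  - exact: integrable_abse.
  - apply/aeW => x n _; rewrite patchE; case: ifP => // _.
    by rewrite abse0; exact: abse_ge0.
  move=> _ _; rewrite /Rintegral fineK; last exact: integrable_fin_num.
  by under eq_fun do rewrite -integral_mkcond.
have intA n : \int[leb]_(x in A n) dh x = h n.+1%:R - h (- n.+1%:R).
  rewrite /A /Rintegral (@continuous_FTC2 _ dh h)//=.
  - by rewrite -subr_gt0 opprK addr_gt0.
  - exact: continuous_subspaceT.
  - split.
    + by move=> x _; case: (hdh x).
    + by apply: cvg_at_right_filter; exact: ch.
    + by apply: cvg_at_left_filter; exact: ch.
  - by move=> x _; have hx := hdh x; rewrite derive1E derive_val.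
have lim2 : \int[leb]_(x in A n) dh x @[n --> \oo] --> (0 : R).
  under eq_fun do rewrite intA.
  rewrite -(subr0 (0 : R)); apply: cvgB.
    by have := hy; rewrite -(cvg_shiftS (fun n => h n%:R)).
  by have := hNy; rewrite -(cvg_shiftS (fun n => h (- n%:R))).
by rewrite -(cvg_lim _ lim1)// (cvg_lim _ lim2).
Unshelve. all: by end_near. Qed.


Lemma measurable_gaussM u (c : R -> R) : measurable_fun setT c ->
  measurable_fun setT (fun x => expR (- (u * x ^+ 2)) * c x).
Proof. by move=> mc; apply: measurable_funM => //; exact: measurable_gauss. Qed.

Lemma integrable_gaussM u (c : R -> R) : 0 < u -> measurable_fun setT c ->
  (forall x, `|c x| <= 1) ->
  leb.-integrable setT (fun x => (expR (- (u * x ^+ 2)) * c x)%:E).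
Proof.
move=> u0 mc c1; apply: le_integrable (integrable_gauss u0) => //.
  by apply/measurable_EFinP; exact: measurable_gaussM.
move=> x _; rewrite lee_fin normrM !(ger0_norm (expR_ge0 _)).
by rewrite ler_piMr ?expR_ge0.
Qed.

Lemma integrable_gauss_idM u (c : R -> R) : 0 < u -> measurable_fun setT c ->
  (forall x, `|c x| <= 1) ->
  leb.-integrable setT (fun x => (x * expR (- (u * x ^+ 2)) * c x)%:E).
Proof.
move=> u0 mc c1; apply: le_integrable (integrable_gauss_id u0) => //.
  apply/measurable_EFinP; apply: measurable_funM => //.
  by apply: measurable_funM => //; exact: measurable_gauss.
move=> x _; rewrite lee_fin !normrM normr_id !(ger0_norm (expR_ge0 _)).
by rewrite ler_piMr ?mulr_ge0 ?expR_ge0.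
Qed.

Lemma cvg_gauss_nat u : 0 < u -> expR (- (u * n%:R ^+ 2)) @[n --> \oo] --> (0 : R).
Proof.
move=> u0; apply: (@squeeze_cvgr _ _ _ _ (fun=> 0) (fun n => expR (- u) ^+ n)).
- apply: nearW => n; rewrite expR_ge0/= -expRM_natl ler_expR mulrN lerN2.
  rewrite mulrC ler_wpM2l ?(ltW u0)// -natrX ler_nat.
  by case: n => // n; rewrite expnS leq_pmulr// expn_gt0.
- exact: cvg_cst.
- by apply: cvg_expr; rewrite ger0_norm ?expR_ge0// expR_lt1 oppr_lt0.
Qed.

Lemma is_derive_continuous (f : R -> R) x df : is_derive x 1 f df ->
  {for x, continuous f}.
Proof. by case=> fx _; exact/differentiable_continuous/derivable1_diffP. Qed.

(* As a function of [z], the integral solves [G' = - z / (2 u) G]. The phase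
   [theta] is what makes the induction on the dimension go through. *)
Lemma integral_gauss_cos u theta z : 0 < u ->
  \int[leb]_x (expR (- (u * x ^+ 2)) * cos (theta + z * x)) =
  cos theta * expR (- (z ^+ 2 / (4 * u))) * Num.sqrt (pi / u).
Proof.
move=> u0.
have mcos w : measurable_fun setT (fun x : R => cos (theta + w * x)).
  apply: (measurableT_comp (continuous_measurable_fun (@continuous_cos R))).
  by apply: measurable_funD => //; exact: measurable_funM.
have msin w : measurable_fun setT (fun x : R => sin (theta + w * x)).
  apply: (measurableT_comp (continuous_measurable_fun (@continuous_sin R))).
  by apply: measurable_funD => //; exact: measurable_funM.
have cos1 (x : R) : `|cos x| <= 1 by rewrite ler_norml cos_geN1 cos_le1.
have sin1 (x : R) : `|sin x| <= 1 by rewrite ler_norml sin_geN1 sin_le1.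
pose f w x := expR (- (u * x ^+ 2)) * cos (theta + w * x).
pose G w := \int[leb]_x f w x.
pose S w := \int[leb]_x (x * expR (- (u * x ^+ 2)) * sin (theta + w * x)).
have df w x : is_derive w 1 (f ^~ x) (- (x * expR (- (u * x ^+ 2)) * sin (theta + w * x))).
  rewrite /f; apply: is_derive_eq.
  by rewrite /GRing.scale/=; ring.
have d1f w x : (partial1of2 f) w x = - (x * expR (- (u * x ^+ 2)) * sin (theta + w * x)).
  by rewrite partial1of2E; case: (df w x).
(* The bound [|y| exp(- u y^2)] on the derivative of the integrand does not depend on the frequency,
   so a window of any size around [w] would do. *)
have dG w : is_derive w 1 G (- S w).
  have ww : `]w - 1, w + 1[%classic w by rewrite /= in_itv/= ltrBlDr ltrDl ltr01.
  have h1 : forall x, `]w - 1, w + 1[%classic x -> leb.-integrable setT (EFin \o f x).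
    by move=> x _; exact: integrable_gaussM.
  have h2 : forall x y, `]w - 1, w + 1[%classic x -> setT y -> derivable (f ^~ y) x 1.
    by move=> x y _ _; case: (df x y).
  have h3 : forall x y, `]w - 1, w + 1[%classic x -> setT y ->
      `|(partial1of2 f) x y| <= `|y| * expR (- (u * y ^+ 2)).
    move=> x y _ _; rewrite d1f normrN !normrM (ger0_norm (expR_ge0 _)).
    by rewrite ler_piMr ?mulr_ge0 ?expR_ge0.
  have h0 y : 0 <= `|y| * expR (- (u * y ^+ 2)) by rewrite mulr_ge0 ?expR_ge0.
  apply: DeriveDef.
    exact: (derivable_under_integral measurableT ww h1 h2 h0 (integrable_gauss_id u0) h3).
  rewrite -derive1E.
  rewrite (differentiation_under_integral measurableT ww h1 h2 h0 (integrable_gauss_id u0) h3).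
  rewrite /S -mulN1r -RintegralZl//; last exact: integrable_gauss_idM.
  by apply: eq_Rintegral => x _; rewrite d1f mulN1r.
(* This is integration by parts: the derivative of [exp(- u x^2) sin(theta + w x)] integrates to
   zero. *)
have SG w : 2 * u * S w = w * G w.
  pose h x := expR (- (u * x ^+ 2)) * sin (theta + w * x).
  pose dh x := w * f w x - 2 * u * (x * expR (- (u * x ^+ 2)) * sin (theta + w * x)).
  have if1 : leb.-integrable setT (EFin \o f w) by exact: integrable_gaussM.
  have if2 : leb.-integrable setT
      (fun x => (x * expR (- (u * x ^+ 2)) * sin (theta + w * x))%:E).
    exact: integrable_gauss_idM.
  have iw : leb.-integrable setT (fun x => (w * f w x)%:E).
    by under eq_fun do rewrite EFinM; exact: integrableZl.
  have iu : leb.-integrable setT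
      (fun x => (2 * u * (x * expR (- (u * x ^+ 2)) * sin (theta + w * x)))%:E).
    by under eq_fun do rewrite EFinM; exact: integrableZl.
  have h_le x : - expR (- (u * x ^+ 2)) <= h x <= expR (- (u * x ^+ 2)).
    by rewrite -ler_norml normrM ger0_norm ?expR_ge0// ler_piMr ?expR_ge0.
  have gN : - expR (- (u * n%:R ^+ 2)) @[n --> \oo] --> (0 : R).
    by rewrite -oppr0; apply: cvgN; exact: cvg_gauss_nat.
  suff : \int[leb]_x dh x = 0.
    rewrite RintegralB// RintegralZl// RintegralZl// => /eqP.
    by rewrite subr_eq0 => /eqP.
  have e1 x : is_derive x 1 (fun x => expR (- (u * x ^+ 2)))
      (- (2 * u * x) * expR (- (u * x ^+ 2))).
    by apply: is_derive_eq; rewrite /GRing.scale/=; ring.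
  have e2 x : is_derive x 1 (fun x => sin (theta + w * x)) (w * cos (theta + w * x)).
    by apply: is_derive_eq; rewrite /GRing.scale/=; ring.
  have e3 x : is_derive x 1 (fun x => cos (theta + w * x)) (- (w * sin (theta + w * x))).
    by apply: is_derive_eq; rewrite /GRing.scale/=; ring.
  have hdh x : is_derive x 1 h (dh x).
    have := is_deriveM (e1 x) (e2 x).
    by congr is_derive; rewrite /dh /f /GRing.scale/=; ring.
  have cdh : continuous dh.
    move=> x; apply: cvgB; apply: cvgMr; apply: cvgM; try apply: cvgM;
      by [exact: cvg_id|exact: (is_derive_continuous (e1 x))
         |exact: (is_derive_continuous (e2 x))|exact: (is_derive_continuous (e3 x))].
  apply (@integral_derivative_eq0 h dh) => //.
  - by under [EFin \o _]eq_fun do rewrite EFinB; exact: integrableB.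
  - by apply: (squeeze_cvgr _ gN (cvg_gauss_nat u0)); apply: nearW => n; exact: h_le.
  - apply: (squeeze_cvgr _ gN (cvg_gauss_nat u0)); apply: nearW => n.
    by rewrite -(sqrrN n%:R); exact: h_le.
(* Multiplying by the integrating factor of the equation [G' = - w / (2 u) G] gives a constant
   function, whose value at 0 is the plain Gaussian integral. *)
pose H w := G w * expR (w ^+ 2 / (4 * u)).
have dH w : is_derive w 1 H 0.
  have dGw := dG w; rewrite /H; apply: is_derive_eq.
  have -> : S w = w * G w / (2 * u).
    by rewrite -SG mulrAC divff ?mul1r// mulf_neq0 ?gt_eqF.
  by rewrite /GRing.scale/=; field; rewrite gt_eqF.
have HE : H z = H 0 by exact: is_derive_0_is_cst.
have G0 : G 0 = cos theta * Num.sqrt (pi / u).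
  rewrite /G /f.
  under eq_Rintegral do rewrite mul0r addr0 mulrC.
  rewrite RintegralZl//; last exact: integrable_gauss.
  by rewrite /Rintegral integral_gauss.
rewrite -[LHS]/(G z) mulrAC -G0 expRN.
move: HE; rewrite /H expr0n/= mul0r expR0 mulr1 => <-.
by rewrite mulfK// gt_eqF// expR_gt0.
Qed.

End gauss_fourier.

(** * Gaussians and their cosine transforms in dimension n *)

Section gauss_rV.
Context {R : realType}.
Local Notation leb := (@lebesgue_measure R).

Lemma measurable_fun_dotv d (T : measurableType d) n (f g : T -> 'rV[R]_n) :
  (forall i, measurable_fun setT (fun t => f t ord0 i)) ->
  (forall i, measurable_fun setT (fun t => g t ord0 i)) ->
  measurable_fun setT (fun t => dotv (f t) (g t)).
Proof.
by move=> mf mg; apply: measurable_sum => i; exact: measurable_funM.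
Qed.

Lemma measurable_coord n (i : 'I_n) : measurable_fun setT (fun x : 'rV[R]_n => x ord0 i).
Proof. exact: measurable_rV_coord. Qed.

Lemma measurable_dotvv n : measurable_fun setT (fun x : 'rV[R]_n => dotv x x).
Proof. by apply: measurable_fun_dotv => i; exact: measurable_coord. Qed.

Lemma measurable_dotvl n (z : 'rV[R]_n) : measurable_fun setT (fun x => dotv z x).
Proof.
by apply: measurable_fun_dotv => i; [exact: measurable_cst|exact: measurable_coord].
Qed.

Lemma dotvv_ge0 n (x : 'rV[R]_n) : 0 <= dotv x x.
Proof. by apply: sumr_ge0 => i _; rewrite -expr2 sqr_ge0. Qed.

Lemma integral_gauss_rV n (u : R) : 0 < u ->
  (\int[lebesgue_rV R n]_x (expR (- (u * dotv x x)))%:E =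
   (Num.sqrt (pi / u) ^+ n)%:E)%E.
Proof.
move=> u0; transitivity
    (\int[lebesgue_rV R n]_x \prod_(i < n) (expR (- (u * (x ord0 i) ^+ 2)))%:E)%E.
  apply: eq_integral => x _; rewrite prodEFin -expR_sum; congr (expR _)%:E.
  by rewrite /dotv mulr_sumr -sumrN; apply: eq_bigr => i _; rewrite expr2.
rewrite (@ge0_integral_rV_prod _ _ (fun _ a => (expR (- (u * a ^+ 2)))%:E)).
- under eq_bigr do rewrite integral_gauss//.
  by rewrite prodEFin big_const_ord iter_mulr_1.
- by move=> i; apply/measurable_EFinP; exact: measurable_gauss.
- by move=> i a; rewrite lee_fin expR_ge0.
Qed.

Lemma measurable_gauss_rV n (u : R) :
  measurable_fun setT (fun x : 'rV[R]_n => expR (- (u * dotv x x))).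
Proof.
do 2 apply: measurableT_comp => //; apply: measurable_funM => //.
exact: measurable_dotvv.
Qed.

Lemma integrable_gauss_rV n (u : R) : 0 < u ->
  (lebesgue_rV R n).-integrable setT (fun x => (expR (- (u * dotv x x)))%:E).
Proof.
move=> u0; apply/integrableP; split.
  by apply/measurable_EFinP; exact: measurable_gauss_rV.
under eq_integral do rewrite gee0_abs ?lee_fin ?expR_ge0//.
by rewrite integral_gauss_rV// ltry.
Qed.

Lemma measurable_cos_dotv n (theta : R) (z : 'rV[R]_n) :
  measurable_fun setT (fun x => cos (theta + dotv z x)).
Proof.
apply: (measurableT_comp (continuous_measurable_fun (@continuous_cos R))).
by apply: measurable_funD => //; exact: measurable_dotvl.
Qed.

Lemma integrable_gauss_rVM n (u : R) (c : 'rV[R]_n -> R) : 0 < u ->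
  measurable_fun setT c -> (forall x, `|c x| <= 1) ->
  (lebesgue_rV R n).-integrable setT (fun x => (expR (- (u * dotv x x)) * c x)%:E).
Proof.
move=> u0 mc c1; apply: le_integrable (integrable_gauss_rV n u0) => //.
  by apply/measurable_EFinP; apply: measurable_funM => //; exact: measurable_gauss_rV.
move=> x _; rewrite lee_fin normrM !(ger0_norm (expR_ge0 _)).
by rewrite ler_piMr ?expR_ge0.
Qed.

Lemma normr_cos_le1 (x : R) : `|cos x| <= 1.
Proof. by rewrite ler_norml cos_geN1 cos_le1. Qed.

(** Once the first coordinate [a] is frozen, the remaining coordinates see the phase
    [theta + z0 * a]. The induction hypothesis returns this phase as the factor
    [cos(theta + z0 * a)], which is the integrand of the one-dimensional formula. *)
Lemma integral_gauss_cos_rV n (u theta : R) (z : 'rV[R]_n) : 0 < u ->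
  (\int[lebesgue_rV R n]_x (expR (- (u * dotv x x)) * cos (theta + dotv z x))%:E =
   (cos theta * expR (- (dotv z z / (4 * u))) * Num.sqrt (pi / u) ^+ n)%:E)%E.
Proof.
move=> u0; elim: n theta z => [|n IH] theta z.
  rewrite integral_dirac; last 2 first.
  - by [].
  - by apply/measurable_EFinP; apply: measurable_funM;
      [exact: measurable_gauss_rV|exact: measurable_cos_dotv].
  by rewrite diracT mul1e /dotv !big_ord0 mulr0 addr0 mul0r oppr0 expR0 mul1r !mulr1.
rewrite integral_rVS; last first.
  by apply: integrable_gauss_rVM => //; [exact: measurable_cos_dotv
    |move=> x; exact: normr_cos_le1].
have [z0 [z' zE]] : exists z0 z', z = rV_cons (z0, z').
  exists (rV_uncons z).1, (rV_uncons z).2; apply/rowP => i; rewrite mxE /=.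
  by case: unliftP => [j ->|->]; rewrite ?mxE.
have dotv_cons (a b : R) (v w : 'rV[R]_n) :
    dotv (rV_cons (a, v)) (rV_cons (b, w)) = a * b + dotv v w.
  rewrite /dotv big_ord_recl !mxE unlift_none /=; congr (_ + _).
  by apply: eq_bigr => i _; rewrite !mxE liftK.
rewrite {}zE; under eq_integral => a _.
  under eq_integral => v _.
    rewrite !dotv_cons mulrDr opprD expRD addrA -mulrA EFinM.
    over.
  rewrite integralZl//=; last first.
    by apply: integrable_gauss_rVM => //; [exact: measurable_cos_dotv
      |move=> x; exact: normr_cos_le1].
  rewrite IH -EFinM.
  over.
rewrite dotv_cons.
have i1 : leb.-integrable setT
    (fun a => (expR (- (u * a ^+ 2)) * cos (theta + z0 * a))%:E).
  apply: integrable_gaussM => //; last by move=> x; exact: normr_cos_le1.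
  apply: (measurableT_comp (continuous_measurable_fun (@continuous_cos R))).
  by apply: measurable_funD => //; exact: measurable_funM.
pose c := expR (- (dotv z' z' / (4 * u))) * Num.sqrt (pi / u) ^+ n.
transitivity (\int[leb]_a (c%:E * (expR (- (u * a ^+ 2)) * cos (theta + z0 * a))%:E))%E.
  by apply: eq_integral => a _; rewrite -EFinM /c; congr EFin; ring.
rewrite integralZl// -[X in (_ * X)%E]fineK; last exact: integrable_fin_num.
rewrite -[fine _]/(\int[leb]_a _) integral_gauss_cos// -EFinM; congr EFin.
rewrite /c (mulrDl (z0 * z0)) opprD expRD expr2 (exprS _ n); ring.
Qed.

End gauss_rV.

(** * From Gaussians to completely monotone functions of the squared norm *)

Section cmono_fourier.
Context {R : realType}.

Lemma measurable_cmono_comp d (T : measurableType d) (q : T -> R) (f : R -> R) :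
  measurable_fun setT q -> (forall x, 0 <= q x) -> cmono f ->
  measurable_fun setT (f \o q).
Proof.
move=> mq q0 cf.
apply: (@measurable_comp _ _ _ _ _ _ (`[0, +oo[%classic : set R)) => //.
- by move=> _ [x _ <-]; rewrite /= in_itv/= andbT.
- exact: cmono_measurable.
Qed.

Lemma integrable_cmonoM d (T : measurableType d) (mu : {measure set T -> \bar R})
    (K q : T -> R) (f : R -> R) :
  mu.-integrable setT (EFin \o K) -> measurable_fun setT q ->
  (forall x, 0 <= q x) -> cmono f ->
  mu.-integrable setT (fun x => (K x * f (q x))%:E).
Proof.
move=> iK mq q0 cf.
have mK : measurable_fun setT K by apply/measurable_EFinP; move/measurable_int: iK.
apply: le_integrable (integrableZl _ (f 0) iK) => //.
  by apply/measurable_EFinP; apply: measurable_funM => //; exact: measurable_cmono_comp.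
move=> x _; rewrite -EFinM lee_fin !normrM mulrC ler_wpM2r//.
have /andP[f0 fle] := cmono_bounds cf (q0 x).
by rewrite !ger0_norm// (le_trans f0 fle).
Qed.

(** Nonnegativity of a linear functional is inherited by sums, nonnegative multiples and limits, so
    only exponentials have to be tested. Integrability of [K] lets a multiple of [|K|] dominate in
    the limit step. *)
Lemma cmono_integral_ge0 d (T : measurableType d) (mu : {measure set T -> \bar R})
    (K q : T -> R) (f : R -> R) :
  mu.-integrable setT (EFin \o K) -> measurable_fun setT q ->
  (forall x, 0 <= q x) ->
  (forall u, 0 <= u -> 0 <= \int[mu]_x (K x * expR (- (u * q x)))) ->
  cmono f -> 0 <= \int[mu]_x (K x * f (q x)).
Proof.
move=> iK mq q0 Kexp; elim=> {f}[u u0|f g cf IHf cg IHg|c f c0 cf IH|f_ f cf IH ff].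
- exact: Kexp.
- under eq_Rintegral do rewrite mulrDr.
  by rewrite RintegralD//; [exact: addr_ge0|exact: integrable_cmonoM..].
- under eq_Rintegral do rewrite mulrCA.
  by rewrite RintegralZl//; [exact: mulr_ge0|exact: integrable_cmonoM].
have cf' := cmono_lim cf ff.
have cvgf0 : cvgn (fun n => f_ n 0) by apply/cvg_ex; exists (f 0); exact: ff.
have [M [_ /(_ (M + 1))]] := cvg_seq_bounded cvgf0.
rewrite ltrDl ltr01 => /(_ isT) fM.
have cvg_int : \int[mu]_x (K x * f_ n (q x)) @[n --> \oo] --> \int[mu]_x (K x * f (q x)).
  apply: fine_cvg.
  have [] := @dominated_convergence _ _ _ mu setT measurableT
    (fun n x => (K x * f_ n (q x))%:E) (fun x => (K x * f (q x))%:E)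
    (fun x => (M + 1)%:E * `|(EFin \o K) x|)%E => //.
  - by move=> n; have /measurable_int := integrable_cmonoM iK mq q0 (cf n).
  - by have /measurable_int := integrable_cmonoM iK mq q0 cf'.
  - apply/aeW => x _; apply: cvg_EFin; first exact: nearW.
    by apply: cvgMr; exact: ff.
  - by apply: integrableZl => //; exact: integrable_abse.
  - apply/aeW => x n _; rewrite abse_EFin -EFinM lee_fin normrM mulrC ler_wpM2r//.
    have /andP[f0 fle] := cmono_bounds (cf n) (q0 x).
    by rewrite ger0_norm// (le_trans fle)// (le_trans (ler_norm _))//; exact: fM.
  move=> i _; rewrite /Rintegral fineK//; exact: integrable_fin_num.
by apply: (ler_cvg_to (cvg_cst 0) cvg_int); exact: nearW.
Qed.

(* The constant 1 / (2 n) is chosen so that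
   (1 + r^2 / (2 n v))^(n / 2) <= exp (r^2 / (4 v)). *)
Lemma gauss_fourier_le n (v r2 : R) : (0 < n)%N -> 0 < v -> 0 <= r2 ->
  expR (- (r2 / (4 * v))) * Num.sqrt (pi / v) ^+ n <=
  Num.sqrt (pi / (v + r2 / (2 * n%:R))) ^+ n.
Proof.
move=> n0 v0 r0; have nR0 : 0 < n%:R :> R by rewrite ltr0n.
pose w := r2 / (2 * n%:R * v).
have w0 : 0 <= w by rewrite divr_ge0// ltW// !mulr_gt0.
have -> : expR (- (r2 / (4 * v))) = expR (- (w / 2)) ^+ n.
  by rewrite -expRM_natl; congr expR; rewrite /w; field; rewrite !gt_eqF.
rewrite -exprMn lerXn2r ?nnegrE ?mulr_ge0 ?expR_ge0//.
have -> : expR (- (w / 2)) = Num.sqrt (expR (- w)).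
  have -> : expR (- w) = expR (- (w / 2)) ^+ 2.
    by rewrite -expRM_natl; congr expR; field.
  by rewrite sqrtr_sqr ger0_norm ?expR_ge0.
rewrite -sqrtrM ?expR_ge0// ler_wsqrtr//.
have -> : v + r2 / (2 * n%:R) = v * (1 + w) by rewrite /w; field; rewrite !gt_eqF.
have w1 : 0 < 1 + w by rewrite ltr_pwDl.
rewrite invfM [leRHS]mulrA [leLHS]mulrC ler_wpM2l ?divr_ge0 ?pi_ge0 ?(ltW v0)//.
by rewrite expRN lef_pV2 ?posrE ?expR_gt0// expR_ge1Dx.
Qed.

(** The kernel to test against exponentials would be the damped Gaussian minus the cosine, but this
    is not integrable on its own. It is multiplied by [exp(- e |x|^2)], the inequality is proved for
    each [e > 0], and [e] tends to 0 under the majorant [2 f(|x|^2)]. *)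
Lemma cmono_fourier_le n (f : R -> R) (z : 'rV[R]_n) : (0 < n)%N -> cmono f ->
  (lebesgue_rV R n).-integrable setT (fun x => (f (dotv x x))%:E) ->
  \int[lebesgue_rV R n]_x (f (dotv x x) * cos (dotv z x)) <=
  \int[lebesgue_rV R n]_x
    (f (dotv x x) * expR (- (dotv z z / (2 * n%:R) * dotv x x))).
Proof.
move=> n0 cf if_; set c := dotv z z / (2 * n%:R).
have c0 : 0 <= c by rewrite divr_ge0 ?dotvv_ge0// mulr_ge0.
have mq := @measurable_dotvv R n; have q0 := @dotvv_ge0 R n.
have mcos : measurable_fun setT (fun x => cos (dotv z x)).
  apply: (measurableT_comp (continuous_measurable_fun (@continuous_cos R))).
  exact: measurable_dotvl.
have mexp := @measurable_gauss_rV R n c.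
have exp1 (x : 'rV[R]_n) : `|expR (- (c * dotv x x))| <= 1.
  by rewrite ger0_norm ?expR_ge0// expR_le1 oppr_le0 mulr_ge0.
have iM (k : 'rV[R]_n -> R) : measurable_fun setT k -> (forall x, `|k x| <= 1) ->
    (lebesgue_rV R n).-integrable setT (fun x => (f (dotv x x) * k x)%:E).
  move=> mk k1; apply: le_integrable if_ => //.
    apply/measurable_EFinP; apply: measurable_funM => //.
    exact: measurable_cmono_comp.
  by move=> x _; rewrite lee_fin normrM ler_piMr.
have i1 := iM _ mcos (fun x => normr_cos_le1 _).
have i2 := iM _ mexp exp1.
rewrite -subr_ge0 -RintegralB//.
pose K e x := expR (- (e * dotv x x)) * (expR (- (c * dotv x x)) - cos (dotv z x)).
have Kint e : 0 < e -> (lebesgue_rV R n).-integrable setT (EFin \o K e).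
  move=> e0; rewrite /K.
  under [EFin \o _]eq_fun do rewrite /= mulrBr EFinB.
  apply: integrableB => //; apply: integrable_gauss_rVM => //.
  by move=> x; exact: normr_cos_le1.
(* Against [exp(- u |x|^2)] both parts are explicit: Gaussians of parameters [e + u + c] and
   [e + u], compared by [gauss_fourier_le] with [v = e + u]. *)
have Kexp e u : 0 < e -> 0 <= u ->
    0 <= \int[lebesgue_rV R n]_x (K e x * expR (- (u * dotv x x))).
  move=> e0 u0; have v0 : 0 < e + u by rewrite ltr_pwDl.
  have vc0 : 0 < e + u + c by rewrite ltr_pwDl.
  under eq_Rintegral => x _.
    rewrite (_ : _ * _ = expR (- ((e + u + c) * dotv x x)) -
        expR (- ((e + u) * dotv x x)) * cos (0 + dotv z x)); last first.
      by rewrite /K !mulrDl !opprD !expRD add0r; ring.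
    over.
  have ic : (lebesgue_rV R n).-integrable setT
      (fun x => (expR (- ((e + u) * dotv x x)) * cos (0 + dotv z x))%:E).
    apply: integrable_gauss_rVM => //; last by move=> x; exact: normr_cos_le1.
    exact: measurable_cos_dotv.
  rewrite RintegralB//; last exact: integrable_gauss_rV.
  rewrite /Rintegral integral_gauss_rV// integral_gauss_cos_rV//= cos0 mul1r.
  by rewrite subr_ge0 gauss_fourier_le.
pose h m : R := m.+1%:R^-1.
have h0 m : 0 < h m by rewrite invr_gt0.
have cvg_int : \int[lebesgue_rV R n]_x (K (h m) x * f (dotv x x)) @[m --> \oo] -->
    \int[lebesgue_rV R n]_x (f (dotv x x) * expR (- (c * dotv x x)) -
                             f (dotv x x) * cos (dotv z x)).
  apply: fine_cvg.
  have [] := @dominated_convergence _ _ _ (lebesgue_rV R n) setT measurableT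
    (fun m x => (K (h m) x * f (dotv x x))%:E)
    (fun x => (f (dotv x x) * expR (- (c * dotv x x)) - f (dotv x x) * cos (dotv z x))%:E)
    (fun x => 2%:E * (f (dotv x x))%:E)%E => //.
  - by move=> m; have /measurable_int := integrable_cmonoM (Kint _ (h0 m)) mq q0 cf.
  - have := integrableB measurableT i2 i1.
    by move=> /measurable_int.
  - apply/aeW => x _; apply: cvg_EFin; first exact: nearW.
    rewrite [X in _ --> X](_ : _ =
      1 * (expR (- (c * dotv x x)) - cos (dotv z x)) * f (dotv x x)); last by ring.
    apply: cvgMl; apply: cvgMl.
    rewrite -[X in _ --> X]expR0.
    apply: (@continuous_cvg _ _ _ _ _ _ expR); first exact: continuous_expR.
    rewrite -oppr0 -(mul0r (dotv x x)); apply: cvgN; apply: cvgMl.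
    exact: cvg_harmonic.
  - exact: integrableZl.
  - apply/aeW => x m _; rewrite abse_EFin -EFinM lee_fin !normrM.
    rewrite (ger0_norm (cmono_ge0 cf (q0 x))) ler_wpM2r ?cmono_ge0//.
    rewrite -(mul1r 2) ler_pM//.
      by rewrite ger0_norm ?expR_ge0// expR_le1 oppr_le0 mulr_ge0// ltW.
    by rewrite (le_trans (ler_normB _ _))// -[2]/(1 + 1) lerD// normr_cos_le1.
  move=> i _; rewrite /Rintegral fineK//; exact: integrable_fin_num.
apply: (ler_cvg_to (cvg_cst 0) cvg_int); apply: nearW => m.
by apply: cmono_integral_ge0 cf => // [|u u0]; [exact: Kint|exact: Kexp].
Qed.

End cmono_fourier.

(** * Integrability of the multiplier *)

Section symbol_integrable.
Context {R : realType}.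
Local Notation leb := (@lebesgue_measure R).

Lemma ge0_integral_even (f : R -> \bar R) : measurable_fun setT f ->
  (forall x, 0 <= f x)%E -> (forall x, f (- x) = f x) ->
  (\int[leb]_x f x = 2%:E * \int[leb]_(x in `[0%R, +oo[) f x)%E.
Proof.
move=> mf f0 fE.
rewrite -[in LHS](setUv (`[0%R, +oo[%classic : set R)) ge0_integral_setU//=; last 3 first.
- exact: measurableC.
- by rewrite setUv.
- exact/disj_setPCl.
rewrite mule_natl mule2n; congr +%E.
rewrite setCitvr integral_itv_bndo_bndc; last exact: measurable_funTS.
rewrite ge0_integration_by_substitution0//.
by apply: eq_integral => x _; rewrite fE.
Qed.

Lemma integral_oneDsqrV_lty :
  (\int[leb]_x ((1 + x ^+ 2)^-1)%:E < +oo)%E.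
Proof.
rewrite (@ge0_symfun_integralT _ (fun x => (1 + x ^+ 2)^-1)).
- rewrite -set_itvcy integral0y_oneDsqr -EFinM ltry//.
- by move=> x; rewrite invr_ge0 addr_ge0// sqr_ge0.
- exact: continuous_oneDsqrV.
- by move=> x /=; rewrite sqrrN.
Qed.

Lemma integral_addsqrV_lty (M : R) : 0 < M ->
  (\int[leb]_x ((x ^+ 2 + M)^-1)%:E < +oo)%E.
Proof.
move=> M0; pose c := 1 + M^-1.
have mV (b : R) : 0 < b -> measurable_fun setT (fun x : R => (x ^+ 2 + b)^-1).
  move=> b0; apply: continuous_measurable_fun => x; apply: cvgV.
    by rewrite gt_eqF// ltr_wpDl// sqr_ge0.
  by apply: cvgD; [exact: exprn_continuous|exact: cvg_cst].
apply: (@le_lt_trans _ _ (\int[leb]_x (c%:E * ((1 + x ^+ 2)^-1)%:E))%E).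
  apply: ge0_le_integral => //.
  - by move=> x _; rewrite lee_fin invr_ge0 addr_ge0 ?sqr_ge0// ltW.
  - by apply/measurable_EFinP; exact: mV.
  - apply: measurable_funeM; apply/measurable_EFinP.
    by under eq_fun do rewrite addrC; exact: mV.
  - move=> x _; rewrite -EFinM lee_fin.
    have x0 := sqr_ge0 x.
    rewrite ler_pdivlMr ?ltr_pwDl// mulrC ler_pdivrMr ?ltr_wpDl//.
    rewrite /c mulrDl mul1r mulrDr mulVf ?gt_eqF//.
    have : 0 <= M^-1 * x ^+ 2 by rewrite mulr_ge0// invr_ge0 ltW.
    lra.
rewrite ge0_integralZl//.
- by rewrite lte_mul_pinfty ?integral_oneDsqrV_lty// lee_fin addr_ge0// invr_ge0 ltW.
- by apply/measurable_EFinP; under eq_fun do rewrite addrC; exact: mV.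
- by move=> x _; rewrite lee_fin invr_ge0 addr_ge0 ?sqr_ge0.
- by rewrite lee_fin addr_ge0// invr_ge0 ltW.
Qed.

Lemma sqr_coord_le_dotvv n (x : 'rV[R]_n) i : x ord0 i ^+ 2 <= dotv x x.
Proof.
rewrite /dotv (bigD1 i)//= -expr2 lerDl; apply: sumr_ge0 => j _.
by rewrite -expr2 sqr_ge0.
Qed.

Lemma prodr_ord_le n (h : 'I_n -> R) c : (forall i, 0 <= h i <= c) ->
  \prod_(i < n) h i <= c ^+ n.
Proof.
move=> hc; rewrite -[c ^+ n]iter_mulr_1 -big_const_ord.
by apply: ler_prod => i _.
Qed.

(** The power [n] is larger than convergence requires, but it allows one factor per coordinate:
    [|x|^2 + M >= x_i^2 + M] for each [i]. *)
Lemma integrable_addV_rV n (M : R) : 0 < M ->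
  (lebesgue_rV R n).-integrable setT (fun x => ((dotv x x + M) ^- n)%:E).
Proof.
move=> M0.
have pos (a : R) : 0 <= a -> 0 < a + M by move=> a0; rewrite ltr_wpDl.
have mV : measurable_fun setT (fun x : 'rV[R]_n => (dotv x x + M) ^- n).
  have mq : measurable_fun setT (fun x : 'rV[R]_n => (dotv x x + M) `^ (- n%:R)).
    apply: (measurableT_comp (measurable_powR _)).
    by apply: measurable_funD => //; exact: measurable_dotvv.
  apply: eq_measurable_fun mq => x _.
  by rewrite powR_invn// ltW// pos// dotvv_ge0.
apply/integrableP; split; first exact/measurable_EFinP.
have V0 (x : 'rV[R]_n) : 0 <= (dotv x x + M) ^- n.
  by rewrite invr_ge0 exprn_ge0// ltW// pos// dotvv_ge0.
under eq_integral do rewrite gee0_abs ?lee_fin//.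
apply: (@le_lt_trans _ _ (\int[lebesgue_rV R n]_x
    \prod_(i < n) ((x ord0 i ^+ 2 + M)^-1)%:E)%E).
  apply: ge0_le_integral => //.
  - by move=> x _; rewrite lee_fin.
  - exact/measurable_EFinP.
  - apply: measurable_fun_prode => i; apply/measurable_EFinP.
    have mc : measurable_fun setT (fun x : 'rV[R]_n => (x ord0 i ^+ 2 + M) `^ (-1)).
      apply: (measurableT_comp (measurable_powR _)); apply: measurable_funD => //.
      by apply: measurable_funX; exact: measurable_coord.
    by apply: eq_measurable_fun mc => x _; rewrite powR_inv1// ltW// pos// sqr_ge0.
  - move=> x _; rewrite prodEFin lee_fin prodfV lef_pV2 ?posrE.
    + apply: prodr_ord_le => i; rewrite ltW ?pos ?sqr_ge0//= lerD2r.
      exact: sqr_coord_le_dotvv.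
    + by rewrite exprn_gt0// pos// dotvv_ge0.
    + by apply: prodr_gt0 => i _; rewrite pos// sqr_ge0.
rewrite (@ge0_integral_rV_prod _ _ (fun _ a => ((a ^+ 2 + M)^-1)%:E)).
- have : (\int[leb]_a ((a ^+ 2 + M)^-1)%:E)%E \is a fin_num.
    rewrite ge0_fin_numE ?integral_addsqrV_lty//.
    by apply: integral_ge0 => a _; rewrite lee_fin invr_ge0 ltW// pos// sqr_ge0.
  by move=> /fineK <-; rewrite prodEFin ltry.
- move=> i; apply/measurable_EFinP; apply: continuous_measurable_fun => x.
  apply: cvgV; first by rewrite gt_eqF// pos// sqr_ge0.
  by apply: cvgD; [exact: exprn_continuous|exact: cvg_cst].
- by move=> i a; rewrite lee_fin invr_ge0 ltW// pos// sqr_ge0.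
Qed.

(** This is [y / N <= exp(y / N)] raised to the power [- N]; it converts exponential decay into
    polynomial decay of any prescribed order. *)
Lemma expRN_powR_le (N y : R) : 0 < N -> 0 < y -> expR (- y) <= (y / N) `^ (- N).
Proof.
move=> N0 y0; rewrite powRN expRN lef_pV2 ?posrE ?expR_gt0 ?powR_gt0 ?divr_gt0//.
have -> : expR y = expR (y / N) `^ N.
  by rewrite /powR gt_eqF ?expR_gt0// expRK; congr expR; field; rewrite gt_eqF.
apply: ge0_ler_powR; rewrite ?nnegrE ?expR_ge0 ?divr_ge0 ?ltW//.
by rewrite (lt_le_trans _ (expR_ge1Dx _))// ltrDr.
Qed.

Lemma integrable_expN_powR n (t beta M : R) : 0 < t -> 0 < beta -> 0 < M ->
  (lebesgue_rV R n).-integrable setT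
    (fun x => (expR (- (t * ((dotv x x + M) `^ beta - M `^ beta))))%:E).
Proof.
move=> t0 b0 M0; have pos (x : 'rV[R]_n) : 0 < dotv x x + M.
  by rewrite ltr_wpDl ?dotvv_ge0.
(* The choice gives [beta * N = n + 1]. The power beyond [n] keeps [N] positive in dimension 0 and
   is absorbed by the factor [M^-1] of [C]. *)
pose N := n.+1%:R / beta; have N0 : 0 < N by rewrite divr_gt0.
pose C := expR (t * M `^ beta) * (t / N) `^ (- N) * M^-1.
apply: le_integrable (integrableZl _ C (integrable_addV_rV n M0)) => //.
  apply/measurable_EFinP; do 2 apply: measurableT_comp => //.
  apply: measurable_funM => //; apply: measurable_funB => //.
  apply: (measurableT_comp (measurable_powR _)); apply: measurable_funD => //.
  exact: measurable_dotvv.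
move=> x _; rewrite -EFinM lee_fin ger0_norm ?expR_ge0// ger0_norm; last first.
  rewrite !mulr_ge0 ?invr_ge0 ?expR_ge0 ?powR_ge0 ?(ltW M0)//.
  by rewrite exprn_ge0// ltW.
rewrite /C mulrBr opprB expRD -!mulrA.
apply: ler_wpM2l; first exact: expR_ge0.
have tv0 : 0 < t * (dotv x x + M) `^ beta by rewrite mulr_gt0// powR_gt0.
apply: (le_trans (expRN_powR_le N0 tv0)).
have -> : t * (dotv x x + M) `^ beta / N = t / N * (dotv x x + M) `^ beta by ring.
rewrite [leLHS]powRM ?divr_ge0 ?powR_ge0 ?(ltW t0) ?(ltW b0)// ler_wpM2l ?powR_ge0//.
rewrite -powRrM mulrN (_ : beta * N = n.+1%:R); last by rewrite /N mulrC divfK// gt_eqF.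
rewrite powR_invn ?(ltW (pos x))// exprS invfM ler_wpM2r//.
  by rewrite invr_ge0 exprn_ge0// ltW.
by rewrite lef_pV2 ?posrE// lerDr dotvv_ge0.
Qed.

End symbol_integrable.

(** * Boxes as test sets *)

Section boxes.
Context {R : realType}.

Lemma Lfun_indic d (T : measurableType d) (mu : {measure set T -> \bar R})
    (A : set T) (q : R) : measurable A -> (mu A < +oo)%E -> 0 < q ->
  (\1_A : T -> R) \in Lfun mu q%:E.
Proof.
move=> mA Aoo q0; rewrite inE; apply/andP; split; rewrite inE/=.
  exact: measurable_indic.
rewrite /finite_norm unlock /= poweR_lty//.
rewrite (eq_integral (fun x => (\1_A x)%:E)); last first.
  move=> x _; rewrite indicE /=; case: (x \in A) => /=.
    by rewrite normr1 powR1.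
  by rewrite normr0 powR0// gt_eqF.
by rewrite integral_indic// setIT.
Qed.

Lemma Lfun_0 d (T : measurableType d) (mu : {measure set T -> \bar R}) (q : R) :
  0 < q -> (fun _ : T => 0 : R) \in Lfun mu q%:E.
Proof.
move=> q0; rewrite inE; apply/andP; split; rewrite inE/=; first exact: measurable_cst.
by rewrite /finite_norm [X in Lnorm _ _ X](_ : _ = cst 0%E)// Lnorm0 ?ltry// gt_eqF.
Qed.

(** For positive [rho] this is the open ball of the sup norm. Its indicator factors over the
    coordinates, so measurability and volume reduce to intervals, which a Euclidean ball would not
    allow. *)
Definition box n (c : 'rV[R]_n) (rho : R) : set 'rV[R]_n :=
  [set y | forall i, `|y ord0 i - c ord0 i| < rho].

Lemma box_indicE n (c : 'rV[R]_n) rho y :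
  \1_(box c rho) y =
  \prod_(i < n) \1_(`]c ord0 i - rho, c ord0 i + rho[%classic : set R) (y ord0 i) :> R.
Proof.
have inI i : (y ord0 i \in (`]c ord0 i - rho, c ord0 i + rho[%classic : set R)) =
    (`|y ord0 i - c ord0 i| < rho).
  by rewrite mem_setE in_itv/= ltr_distl.
have [yb|yb] := pselect (box c rho y).
  rewrite indicE mem_set// big1// => i _; rewrite indicE inI; by rewrite yb.
rewrite indicE memNset//=; apply/esym/eqP; rewrite prodf_seq_eq0.
apply/hasP; move/existsNP : yb => [i /negP yi]; exists i; first exact: mem_index_enum.
by rewrite indicE inI (negbTE yi) /=.
Qed.

Lemma measurable_box n (c : 'rV[R]_n) rho : measurable (box c rho).
Proof.
apply/(measurable_indicP R); rewrite (_ : \1_ _ = fun y : 'rV[R]_n => \prod_(i < n)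
  \1_(`]c ord0 i - rho, c ord0 i + rho[%classic : set R) (y ord0 i)); last first.
  by apply/funext => y; exact: box_indicE.
apply: measurable_prod => i _; apply: measurableT_comp; last exact: measurable_coord.
exact: measurable_indic.
Qed.

Lemma lebesgue_rV_box n (c : 'rV[R]_n) rho : 0 < rho ->
  lebesgue_rV R n (box c rho) = ((2 * rho) ^+ n)%:E.
Proof.
move=> rho0; rewrite -[box c rho]setIT -integral_indic//; last exact: measurable_box.
under eq_integral do rewrite box_indicE -prodEFin.
rewrite (@ge0_integral_rV_prod _ _ (fun i a =>
  (\1_(`]c ord0 i - rho, c ord0 i + rho[%classic : set R) a)%:E)).
- under eq_bigr => i _.
    rewrite integral_indic// setIT /= lebesgue_measure_itv/= lte_fin.
    rewrite ltrD2l gt0_cp// -EFinB opprD addrACA subrr add0r.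
    over.
  by rewrite prodEFin big_const_ord iter_mulr_1 opprK mulr_natl mulr2n.
- by move=> i; apply/measurable_EFinP; exact: measurable_indic.
- by move=> i a; rewrite lee_fin.
Qed.

Lemma nbhs_box n (x : 'rV[R]_n) (P : set 'rV[R]_n) : nbhs x P ->
  exists2 rho, 0 < rho & forall y, box x rho y -> P y.
Proof.
move=> /nbhs_ballP[e /= e0 eP]; exists e => // y yb; apply: eP.
split=> // i j; rewrite (ord1 i); move: (yb j).
by rewrite /ball/= distrC.
Qed.

Lemma Rintegral_Fubini d1 d2 (T1 : measurableType d1) (T2 : measurableType d2)
    (m1 : {sigma_finite_measure set T1 -> \bar R})
    (m2 : {sigma_finite_measure set T2 -> \bar R}) (h : T1 * T2 -> R) :
  (m1 \x m2)%E.-integrable setT (EFin \o h) ->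
  (forall x, m2.-integrable setT (fun y => (h (x, y))%:E)) ->
  (forall y, m1.-integrable setT (fun x => (h (x, y))%:E)) ->
  \int[m1]_x \int[m2]_y h (x, y) = \int[m2]_y \int[m1]_x h (x, y).
Proof.
move=> ih ih1 ih2; rewrite /Rintegral; congr fine.
transitivity (\int[m1]_x \int[m2]_y (EFin \o h) (x, y))%E.
  by apply: eq_integral => x _; rewrite fineK//; exact: integrable_fin_num.
rewrite Fubini//.
by apply: eq_integral => y _; rewrite fineK//; exact: integrable_fin_num.
Qed.

End boxes.

(** * The heat kernel *)

Section heat_kernel_bound.
Context {R : realType} (n : nat).
Implicit Types (alpha m t : R) (x y z xi : 'rV[R]_n).
Local Notation mu := (lebesgue_rV R n).
Local Open Scope complex_scope.

Lemma symbolLE alpha m xi : 0 < alpha -> 0 < m ->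
  symbolL alpha m xi =
  (dotv xi xi + m `^ (2 / alpha)) `^ (alpha / 2) - m `^ (2 / alpha) `^ (alpha / 2).
Proof.
move=> a0 m0; rewrite /symbolL /enorm sqr_sqrtr ?dotvv_ge0//.
rewrite -powRrM (_ : 2 / alpha * (alpha / 2) = 1) ?powRr1 ?(ltW m0)//.
by field; rewrite gt_eqF.
Qed.

Lemma integrable_exp_symbolL alpha m t : 0 < alpha -> 0 < m -> 0 < t ->
  mu.-integrable setT (fun xi => (expR (- (t * symbolL alpha m xi)))%:E).
Proof.
move=> a0 m0 t0; under eq_fun do rewrite symbolLE//.
by apply: integrable_expN_powR; rewrite ?divr_gt0 ?powR_gt0.
Qed.

Lemma fourier_symbolL_le alpha m t z : (0 < n)%N -> 0 < alpha < 2 -> 0 < m -> 0 < t ->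
  \int[mu]_xi (expR (- (t * symbolL alpha m xi)) * cos (dotv z xi)) <=
  \int[mu]_xi (expR (- (t * symbolL alpha m xi)) *
               expR (- (dotv z z / (2 * n%:R) * dotv xi xi))).
Proof.
move=> n0 /andP[a0 a2] m0 t0.
pose f s := expR (- (t * ((s + m `^ (2 / alpha)) `^ (alpha / 2) -
                         m `^ (2 / alpha) `^ (alpha / 2)))).
have cf : cmono f.
  apply: bernstein_powR; [by rewrite powR_gt0| |exact: ltW].
  by rewrite divr_gt0//= ltr_pdivrMr// mul1r.
have fE xi : expR (- (t * symbolL alpha m xi)) = f (dotv xi xi) by rewrite symbolLE.
under eq_Rintegral do rewrite fE; under [leRHS]eq_Rintegral do rewrite fE.
apply: cmono_fourier_le => //.
by apply: integrable_expN_powR; rewrite ?divr_gt0 ?powR_gt0.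
Qed.

Lemma complex_ReM (v w : R[i]) : complex.Re (v * w) =
  complex.Re v * complex.Re w - complex.Im v * complex.Im w.
Proof. by case: v w => [a b] [c d]. Qed.

Lemma complex_ImM (v w : R[i]) : complex.Im (v * w) =
  complex.Re v * complex.Im w + complex.Im v * complex.Re w.
Proof. by case: v w => [a b] [c d]. Qed.

Lemma dotvC x y : dotv x y = dotv y x.
Proof. by apply: eq_bigr => i _; rewrite mulrC. Qed.

Lemma dotvBl x y z : dotv (x - y) z = dotv x z - dotv y z.
Proof. by rewrite /dotv -sumrB; apply: eq_bigr => i _; rewrite !mxE mulrBl. Qed.

Lemma measurable_cos_dotvB d (T : measurableType d) x (f g : T -> 'rV[R]_n) :
  (forall i, measurable_fun setT (fun u => f u ord0 i)) ->
  (forall i, measurable_fun setT (fun u => g u ord0 i)) ->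
  measurable_fun setT (fun u => cos (dotv (x - f u) (g u))).
Proof.
move=> mf mg.
apply: (measurableT_comp (continuous_measurable_fun (@continuous_cos R))).
apply: measurable_fun_dotv => // i; under eq_fun do rewrite !mxE.
exact: measurable_funB.
Qed.

(** By Fubini and the addition formula for the cosine, the real part of the semigroup acts on an
    indicator as convolution with [(2 pi)^-n q]. This gives access to the kernel without Fourier
    inversion; the real part suffices because [p t] is real-valued. *)
Lemma Re_semigroupL_indic alpha m t (A : set 'rV[R]_n) x :
  0 < alpha -> 0 < m -> 0 < t -> measurable A -> (mu A < +oo)%E ->
  let q z := \int[mu]_xi (expR (- (t * symbolL alpha m xi)) * cos (dotv z xi)) in
  mu.-integrable setT (fun y => (\1_A y * q (x - y))%:E) /\
  complex.Re (semigroupL alpha m t (fun y => (\1_A y : R)%:C) x) =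
  (2 * pi) ^- n * \int[mu]_y (\1_A y * q (x - y)).
Proof.
move=> a0 m0 t0 mA Aoo q.
pose F xi := expR (- (t * symbolL alpha m xi)).
have iF : mu.-integrable setT (EFin \o F) by exact: integrable_exp_symbolL.
have mF : measurable_fun setT F by apply/measurable_EFinP; move/measurable_int: iF.
have m1A : measurable_fun setT (\1_A : _ -> R) by exact: measurable_indic.
have iA : mu.-integrable setT (fun y => (\1_A y : R)%:E).
  apply/integrableP; split; first exact/measurable_EFinP.
  under eq_integral do rewrite gee0_abs ?lee_fin//.
  by rewrite integral_indic// setIT.
have iAM (k : 'rV[R]_n -> R) : measurable_fun setT k -> (forall y, `|k y| <= 1) ->
    mu.-integrable setT (fun y => (k y * \1_A y)%:E).
  move=> mk k1; apply: le_integrable iA => //.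
    by apply/measurable_EFinP; exact: measurable_funM.
  by move=> y _; rewrite lee_fin normrM ler_piMl.
have iFM (k : 'rV[R]_n -> R) : measurable_fun setT k -> (forall y, `|k y| <= 1) ->
    mu.-integrable setT (fun xi => (F xi * k xi)%:E).
  move=> mk k1; apply: le_integrable iF => //.
    by apply/measurable_EFinP; exact: measurable_funM.
  by move=> y _; rewrite lee_fin normrM ler_piMr.
have mdot xi : measurable_fun setT (fun y => dotv y xi).
  by apply: measurable_fun_dotv => i; [exact: measurable_coord|exact: measurable_cst].
have sin1 (a : R) : `|sin a| <= 1 by rewrite ler_norml sin_geN1 sin_le1.
have icos xi : mu.-integrable setT (fun y => (cos (- dotv y xi) * \1_A y)%:E).
  apply: iAM; last by move=> y; exact: normr_cos_le1.
  apply: (measurableT_comp (continuous_measurable_fun (@continuous_cos R))).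
  exact: measurable_funN.
have isin xi : mu.-integrable setT (fun y => (sin (- dotv y xi) * \1_A y)%:E).
  apply: iAM; last by move=> y; exact: sin1.
  apply: (measurableT_comp (continuous_measurable_fun (@continuous_sin R))).
  exact: measurable_funN.
pose h (p : 'rV[R]_n * 'rV[R]_n) := F p.1 * (cos (dotv (x - p.2) p.1) * \1_A p.2).
have Re_integrand xi :
    complex.Re (expi (dotv x xi) * ((F xi)%:C * fourier (fun y => (\1_A y : R)%:C) xi)) =
    \int[mu]_y h (xi, y).
  have fRe : complex.Re (fourier (fun y => (\1_A y : R)%:C) xi) =
      \int[mu]_y (cos (- dotv y xi) * \1_A y).
    by apply: eq_Rintegral => y _; rewrite complex_ReM /= mulr0 subr0 dotvC.
  have fIm : complex.Im (fourier (fun y => (\1_A y : R)%:C) xi) =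
      \int[mu]_y (sin (- dotv y xi) * \1_A y).
    by apply: eq_Rintegral => y _; rewrite complex_ImM /= mulr0 add0r dotvC.
  rewrite complex_ReM [complex.Re (_ * fourier _ _)]complex_ReM.
  rewrite [complex.Im (_ * fourier _ _)]complex_ImM.
  rewrite fRe fIm /= !mul0r subr0 addr0.
  have ic' : mu.-integrable setT
      (fun y => (cos (dotv x xi) * (cos (- dotv y xi) * \1_A y))%:E).
    by under eq_fun do rewrite EFinM; exact: integrableZl.
  have is' : mu.-integrable setT
      (fun y => (sin (dotv x xi) * (sin (- dotv y xi) * \1_A y))%:E).
    by under eq_fun do rewrite EFinM; exact: integrableZl.
  transitivity (F xi * \int[mu]_y (cos (dotv x xi) * (cos (- dotv y xi) * \1_A y) -
                                   sin (dotv x xi) * (sin (- dotv y xi) * \1_A y))).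
    rewrite RintegralB; [|exact: measurableT|exact: ic'|exact: is'].
    rewrite RintegralZl; [|exact: measurableT|exact: icos].
    rewrite RintegralZl; [|exact: measurableT|exact: isin].
    by rewrite mulrBr; congr (_ - _); exact: mulrCA.
  rewrite -RintegralZl//; last first.
    by under [_ \o _]eq_fun do rewrite EFinB; exact: integrableB.
  apply: eq_Rintegral => y _; rewrite /h /= dotvBl cosB cosN sinN; ring.
(* The majorant [F(xi) 1_A(y)] is a product of two integrable functions. *)
have ih : (mu \x mu)%E.-integrable setT (EFin \o h).
  have mh : measurable_fun setT h.
    apply: measurable_funM; first exact: measurableT_comp.
    apply: measurable_funM; last exact: measurableT_comp.
    apply: measurable_cos_dotvB => i.
      by apply: (measurableT_comp (measurable_coord i)).
    by apply: (measurableT_comp (measurable_coord i)).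
  apply/integrable12ltyP; first exact/measurable_EFinP.
  apply: (@le_lt_trans _ _ (\int[mu]_xi \int[mu]_y ((F xi)%:E * (\1_A y)%:E))%E).
    apply: ge0_le_integral => //.
    + by move=> xi _; exact: integral_ge0.
    + apply: (measurable_fun_fubini_tonelli_F (abse \o (EFin \o h))) => //=.
      by apply: measurableT_comp => //; exact/measurable_EFinP.
    + under eq_fun do rewrite integralZl//.
      by apply: emeasurable_funM => //; exact/measurable_EFinP.
    move=> xi _; apply: ge0_le_integral => //.
    + apply: measurableT_comp => //; apply/measurable_EFinP.
      exact: (measurableT_comp mh).
    + by apply: measurable_funeM; exact/measurable_EFinP.
    + move=> y _; rewrite -EFinM lee_fin /h /= normrM ger0_norm ?expR_ge0//.
      rewrite ler_wpM2l ?expR_ge0// normrM (@ger0_norm _ (\1_A y))//.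
      by rewrite ler_piMl// normr_cos_le1.
  under eq_integral do rewrite integralZl//.
  rewrite ge0_integralZr//; [|exact/measurable_EFinP|by move=> xi _; rewrite lee_fin expR_ge0
    |by apply: integral_ge0 => y _; rewrite lee_fin].
  rewrite integral_indic// setIT lte_mul_pinfty//.
  - by apply: integral_ge0 => y _; rewrite lee_fin expR_ge0.
  - exact: integrable_fin_num.
have qE y : \1_A y * q (x - y) = \int[mu]_xi h (xi, y).
  rewrite /q -RintegralZl//; last first.
    apply: iFM; last by move=> ?; exact: normr_cos_le1.
    by under eq_fun do rewrite -[dotv _ _]add0r; exact: measurable_cos_dotv.
  by apply: eq_Rintegral => xi _; rewrite /h /= mulrC mulrA.
have ih1 xi : mu.-integrable setT (fun y => (h (xi, y))%:E).
  rewrite /h/=; under eq_fun do rewrite EFinM; apply: integrableZl => //.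
  apply: iAM; last by move=> ?; exact: normr_cos_le1.
  by apply: measurable_cos_dotvB => i; [exact: measurable_coord|exact: measurable_cst].
have ih2 y : mu.-integrable setT (fun xi => (h (xi, y))%:E).
  rewrite /h/=; apply: iFM.
    apply: measurable_funM => //; apply: measurable_cos_dotvB => i.
      exact: measurable_cst.
    exact: measurable_coord.
  move=> xi; rewrite normrM mulr_ile1// ?normr_cos_le1//.
  by rewrite ger0_norm// indicE; case: (_ \in _).
split.
  have iFc z : mu.-integrable setT (fun xi => (F xi * cos (dotv z xi))%:E).
    apply: iFM; last by move=> ?; exact: normr_cos_le1.
    by under eq_fun do rewrite -[dotv _ _]add0r; exact: measurable_cos_dotv.
  (* Measurability of [1_A(y) q(x - y)] in [y] is read off from Fubini, since this function is the
     inner integral of [h]. *)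
  apply: le_integrable (integrableZl _ (\int[mu]_xi F xi) iA) => //.
    have := measurable_fubini_G ih; apply: eq_measurable_fun => y _.
    by rewrite /fubini_G qE /Rintegral fineK//; exact: integrable_fin_num.
  move=> y _; rewrite -EFinM lee_fin [leLHS]normrM [leRHS]ger0_norm; last first.
    by rewrite mulr_ge0//; apply: Rintegral_ge0 => xi _; exact: expR_ge0.
  rewrite (ger0_norm (_ : 0 <= \1_A y))// mulrC ler_wpM2r//.
  apply: (le_trans (le_normr_Rintegral _ (iFc (x - y)))) => //.
  apply: le_Rintegral; [exact: measurableT| |exact: iF|].
    exact: (integrable_norm (iFc (x - y))).
  move=> xi _; rewrite normrM ger0_norm ?expR_ge0// ler_piMr ?expR_ge0//.
  exact: normr_cos_le1.
transitivity ((2 * pi) ^- n * \int[mu]_xi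
    complex.Re (expi (dotv x xi) * ((F xi)%:C * fourier (fun y => (\1_A y : R)%:C) xi))).
  by rewrite /semigroupL /inv_fourier complex_ReM mul0r subr0.
congr (_ * _); under eq_Rintegral do rewrite Re_integrand.
by rewrite (Rintegral_Fubini ih ih1 ih2); apply: eq_Rintegral => y _; rewrite qE.
Qed.

End heat_kernel_bound.

(** * Pointwise bound on the heat kernel *)

Section heat_kernel_le.
Context {R : realType} (n : nat).
Local Notation mu := (lebesgue_rV R n).
Local Open Scope complex_scope.

Lemma dotvv_gt0 (x : 'rV[R]_n) : x != 0 -> 0 < dotv x x.
Proof.
move=> x0; rewrite lt_neqAle dotvv_ge0 andbT eq_sym; apply: contra x0 => /eqP xx0.
apply/eqP/rowP => i; rewrite mxE; apply/eqP; rewrite -sqrf_eq0 eq_le sqr_ge0 andbT.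
by rewrite -xx0; exact: sqr_coord_le_dotvv.
Qed.

(** Coordinatewise, [z_i^2 >= x_i^2 / 2 - (z_i - x_i)^2], which is the nonnegativity of
    [(2 z_i - x_i)^2]. The radius is chosen so that the subtracted squares sum to at most
    [|x|^2 / 4]. *)
Lemma dotvv_box (x z : 'rV[R]_n) :
  box x (Num.sqrt (dotv x x / (4 * n%:R))) z -> dotv x x / 4 <= dotv z z.
Proof.
move=> zb; have [n0|n0] := posnP n.
  by rewrite /dotv; move: x z zb; rewrite n0 => x z _; rewrite !big_ord0 mul0r.
have nR0 : 0 < n%:R :> R by rewrite ltr0n.
have -> : dotv x x / 4 = \sum_(i < n) (x ord0 i ^+ 2 / 2 - dotv x x / (4 * n%:R)).
  rewrite sumrB sumr_const card_ord -mulr_suml -mulr_natl.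
  under eq_bigr do rewrite expr2.
  by rewrite -/(dotv x x); field; rewrite gt_eqF.
apply: ler_sum => i _.
have : `|z ord0 i - x ord0 i| ^+ 2 <= Num.sqrt (dotv x x / (4 * n%:R)) ^+ 2.
  by rewrite lerXn2r ?nnegrE ?sqrtr_ge0// ltW.
rewrite real_normK ?num_real// sqr_sqrtr; last by rewrite divr_ge0 ?dotvv_ge0// mulr_ge0.
have : 0 <= (2 * z ord0 i - x ord0 i) ^+ 2 by rewrite sqr_ge0.
by rewrite -expr2; nra.
Qed.

Lemma ae_box (P : 'rV[R]_n -> Prop) x rho : 0 < rho ->
  {ae mu, forall y, P y} -> exists2 y, box x rho y & P y.
Proof.
move=> rho0 [N [mN N0 PN]]; apply: contrapT => nP.
have bN : box x rho `<=` N.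
  by move=> y by_; apply: PN => /= Py; apply: nP; exists y.
have : (mu (box x rho) <= mu N)%E.
  by apply: le_measure; rewrite ?inE//; exact: measurable_box.
by rewrite N0 lebesgue_rV_box// lee_fin leNgt exprn_gt0// mulr_gt0.
Qed.

(* The kernel is only known through its action on functions, almost everywhere:
   the indicator of a small box and the continuity of [p t] recover its value at
   [x], and on that box [|x - y|^2 >= |x|^2 / 4]. *)
Lemma heat_kernel_le (alpha m t : R) (p : R -> 'rV[R]_n -> R) (x : 'rV[R]_n) :
  (0 < n)%N -> 0 < alpha < 2 -> 0 < m -> is_heat_kernel alpha m p -> 0 < t ->
  x != 0 ->
  p t x <= (2 * pi) ^- n * \int[mu]_xi (expR (- (t * symbolL alpha m xi)) *
    expR (- (dotv x x / (8 * n%:R) * dotv xi xi))).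
Proof.
move=> n0 a02 m0 hk t0 xneq0; have /andP[a0 a2] := a02.
set B := \int[mu]_xi _; rewrite leNgt; apply/negP => Bp.
have [pcont psemi] := hk t t0.
have nR0 : 0 < n%:R :> R by rewrite ltr0n.
have pi0 : 0 <= (2 * pi) ^- n :> R by rewrite invr_ge0 exprn_ge0// mulr_ge0 ?pi_ge0.
(* The midpoint separates the two sides: near [x] the kernel stays above [c], while the Fourier side
   averages to at most [(2 pi)^-n B < c]. *)
set c := (p t x + (2 * pi) ^- n * B) / 2.
have [cp cB] : c < p t x /\ (2 * pi) ^- n * B < c by rewrite /c; split; lra.
have [r1 r10 r1P] : exists2 r1, 0 < r1 & forall z, box x r1 z -> c < p t z.
  by apply: nbhs_box; exact: (cvgr_gt _ (pcont x)).
pose r2 := Num.sqrt (dotv x x / (4 * n%:R)).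
have r20 : 0 < r2 by rewrite sqrtr_gt0 divr_gt0 ?dotvv_gt0// mulr_gt0.
(* The halving leaves room for two deviations, that of [x'] from [x] and that of [y] from 0, so that
   [x' - y] satisfies both requirements. *)
pose rho := Num.min r1 r2 / 2.
have rho0 : 0 < rho by rewrite divr_gt0// lt_min r10.
have two_rho : rho + rho = Num.min r1 r2 by rewrite /rho; field.
pose A : set 'rV[R]_n := box 0 rho.
have mA : measurable A by exact: measurable_box.
have muA : mu A = ((2 * rho) ^+ n)%:E by exact: lebesgue_rV_box.
have Aoo : (mu A < +oo)%E by rewrite muA ltry.
have LA q : 0 < q -> in_Lp q%:E (fun y => (\1_A y : R)%:C).
  by move=> q0; split; [exact: Lfun_indic|exact: Lfun_0].
(* The null set in the kernel identity depends on the test function and may contain [x], so the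
   identity is used at a nearby point [x']. *)
have [x' x'box [[ip _] eqp]] := ae_box x rho0 (psemi _ (LA 1 ltr01) (LA 2 (ltr0Sn _ _))).
have near_x y : A y -> box x (Num.min r1 r2) (x' - y).
  move=> Ay i; rewrite !mxE addrAC -two_rho (le_lt_trans (ler_normB _ _))//.
  by rewrite ltrD// -[y _ _]subr0; have := Ay i; rewrite mxE.
have iA : mu.-integrable setT (fun y => (\1_A y : R)%:E).
  by apply/Lfun1_integrable; have [] := LA 1 ltr01.
pose q z := \int[mu]_xi (expR (- (t * symbolL alpha m xi)) * cos (dotv z xi)).
have [iq Req] : mu.-integrable setT (fun y => (\1_A y * q (x' - y))%:E) /\
    complex.Re (semigroupL alpha m t (fun y => (\1_A y : R)%:C) x') =
    (2 * pi) ^- n * \int[mu]_y (\1_A y * q (x' - y)).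
  exact: Re_semigroupL_indic.
have qB z : dotv x x / 4 <= dotv z z -> q z <= B.
  move=> xz; apply: (le_trans (fourier_symbolL_le z n0 a02 m0 t0)).
  have iE k : 0 <= k -> mu.-integrable setT (fun xi =>
      (expR (- (t * symbolL alpha m xi)) * expR (- (k * dotv xi xi)))%:E).
    move=> k0; have iF := @integrable_exp_symbolL _ n _ _ _ a0 m0 t0.
    apply: (le_integrable _ _ _ iF) => //.
      apply/measurable_EFinP; apply: measurable_funM.
        by apply/measurable_EFinP; move/measurable_int: iF.
      exact: measurable_gauss_rV.
    move=> xi _; rewrite lee_fin normrM ler_piMr// ger0_norm ?expR_ge0//.
    by rewrite expR_le1 oppr_le0 mulr_ge0// dotvv_ge0.
  apply: le_Rintegral; [by []|apply: iE|apply: iE|].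
  - by rewrite divr_ge0 ?dotvv_ge0// mulr_ge0.
  - by rewrite divr_ge0 ?dotvv_ge0// mulr_ge0.
  move=> xi _; rewrite ler_wpM2l ?expR_ge0// ler_expR lerN2 ler_wpM2r ?dotvv_ge0//.
  have -> : dotv x x / (8 * n%:R) = dotv x x / 4 / (2 * n%:R).
    by field; rewrite gt_eqF.
  by rewrite ler_wpM2r// invr_ge0 mulr_ge0.
have ReE : complex.Re (semigroupL alpha m t (fun y => (\1_A y : R)%:C) x') =
    \int[mu]_y (p t (x' - y) * \1_A y).
  rewrite eqp; apply: eq_Rintegral => y _.
  by rewrite -[LHS]/(complex.Re ((p t (x' - y))%:C * (\1_A y : R)%:C)) complex_ReM /= mul0r subr0.
have intA k : \int[mu]_y (k * \1_A y) = k * (2 * rho) ^+ n.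
  rewrite RintegralZl//; congr (_ * _).
  by rewrite /Rintegral integral_indic// setIT [X in fine X]muA.
have ikA k : mu.-integrable setT (EFin \o (fun y => k * \1_A y)).
  by under [_ \o _]eq_fun do rewrite EFinM; exact: integrableZl.
have rn0 : 0 < (2 * rho) ^+ n by rewrite exprn_gt0// mulr_gt0.
have lb : c * (2 * rho) ^+ n <= \int[mu]_y (p t (x' - y) * \1_A y).
  rewrite -intA; apply: le_Rintegral; [by []|exact: ikA| |].
    apply: eq_integrable ip => // y _; congr EFin.
    by rewrite complex_ReM /= mul0r subr0.
  move=> y _; rewrite indicE; case: (boolP (y \in A)) => [|_]; last by rewrite !mulr0.
  move=> /set_mem Ay; rewrite !mulr1 ltW// r1P// => i.
  by have := near_x y Ay i; rewrite lt_min => /andP[].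
have ub : \int[mu]_y (\1_A y * q (x' - y)) <= B * (2 * rho) ^+ n.
  rewrite -intA; apply: le_Rintegral; [by []|exact: iq|exact: ikA|].
  move=> y _; rewrite indicE; case: (boolP (y \in A)) => [|_]; last by rewrite mulr0 mul0r.
  move=> /set_mem Ay; rewrite mul1r mulr1 qB// dotvv_box// => i.
  by have := near_x y Ay i; rewrite lt_min => /andP[].
have : c * (2 * rho) ^+ n <= (2 * pi) ^- n * (B * (2 * rho) ^+ n).
  by rewrite (le_trans lb)// -ReE Req ler_wpM2l.
by rewrite (mulrA _ B) ler_pM2r// leNgt cB.
Qed.

End heat_kernel_le.

(** * The time integral *)

Section singular_integrals.
Context {R : realType}.
Local Notation leb := (@lebesgue_measure R).

(* [f] need not be measurable: nothing is known about [t |-> p t x]. *)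
Lemma le_integral_ge0 d (T : measurableType d) (mu : {measure set T -> \bar R})
    (D : set T) (f g : T -> \bar R) :
  (forall x, D x -> 0 <= g x)%E -> (forall x, D x -> f x <= g x)%E ->
  (\int[mu]_(x in D) f x <= \int[mu]_(x in D) g x)%E.
Proof.
move=> g0 fg; rewrite integralE.
apply: (@le_trans _ _ (\int[mu]_(x in D) f^\+ x)%E).
  by rewrite geeDl// oppe_le0; apply: integral_ge0 => x _; exact: funeneg_ge0.
rewrite !ge0_integralE//; apply: ereal_sup_le => _ [h hf <-]; exists h => // x.
apply: (le_trans (hf x)); rewrite !patchE; case: ifPn => // /set_mem Dx.
by rewrite funeposE ge_max fg// g0.
Qed.

Lemma integral_expN_le (psi : R) : 0 < psi ->
  (\int[leb]_(t in `]0%R, +oo[) (expR (- (t * psi)))%:E <= (psi^-1)%:E)%E.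
Proof.
move=> psi0.
apply: (@le_trans _ _ (\int[leb]_t (psi^-1%:E * (exponential_pdf psi t)%:E))%E).
  rewrite integral_mkcond; apply: le_integral_ge0 => t _.
    by rewrite -EFinM lee_fin mulr_ge0 ?invr_ge0 ?exponential_pdf_ge0// ltW.
  rewrite patchE; case: ifPn => [|_]; last first.
    by rewrite -EFinM lee_fin mulr_ge0 ?invr_ge0 ?exponential_pdf_ge0// ltW.
  rewrite inE/= in_itv/= andbT => t0; rewrite -EFinM lee_fin exponential_pdfE ?(ltW t0)//.
  by rewrite mulrA mulVf ?gt_eqF// mul1r mulNr (mulrC psi).
rewrite integralZl//; last exact: integrable_exponential_pdf.
by rewrite integral_exponential_pdf// mule1.
Qed.

Lemma integral_powRN_le (rho a : R) : 0 < rho -> 0 < a < 1 ->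
  (\int[leb]_(y in `]0%R, rho]) (y `^ (- a))%:E <= (rho `^ (1 - a) / (1 - a))%:E)%E.
Proof.
move=> rho0 /andP[a0 a1]; have a1' : 0 < 1 - a by rewrite subr_gt0.
(* The integrand is unbounded at 0, so the fundamental theorem is applied away from 0 and monotone
   convergence closes the gap. *)
pose F k : set R := `[rho / k.+1%:R, rho]%classic.
have e0 k : 0 < rho / k.+1%:R by rewrite divr_gt0.
have e1 k : rho / k.+1%:R <= rho by rewrite ler_pdivrMr// ler_peMr ?(ltW rho0)// ler1n.
have UF : `]0%R, rho]%classic = \bigcup_k F k.
  apply/seteqP; split => y /=.
    rewrite in_itv/= => /andP[y0 yr].
    exists (Num.truncn (rho / y)) => //=; rewrite /F/= in_itv/= yr andbT.
    by rewrite ler_pdivrMr// mulrC -ler_pdivrMr// ltW// truncnS_gt.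
  by move=> [k _]; rewrite /F/= !in_itv/= => /andP[/(lt_le_trans (e0 k)) -> ->].
have ndF : nondecreasing_seq F.
  move=> i j ij; apply/subsetPset => y; rewrite /F/= !in_itv/= => /andP[yi ->].
  rewrite andbT (le_trans _ yi)// ler_wpM2l ?(ltW rho0)// lef_pV2 ?posrE//.
  by rewrite ler_nat ltnS.
have mp : measurable_fun setT (fun y : R => (y `^ (- a))%:E).
  by apply/measurable_EFinP; exact: measurable_powR.
have cvgF : (\int[leb]_(y in F k) (y `^ (- a))%:E @[k --> \oo] -->
    \int[leb]_(y in \bigcup_k F k) (y `^ (- a))%:E)%E.
  apply: ge0_nondecreasing_set_cvg_integral => //.
  - by move=> i; exact: measurable_itv.
  - by move=> i; exact: measurable_funTS.
  - by move=> i y _; rewrite lee_fin powR_ge0.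
rewrite UF -(cvg_lim _ cvgF)//; apply: lime_le; first by apply/cvg_ex; eexists; exact: cvgF.
apply: nearW => k.
pose P (y : R) := y `^ (1 - a) / (1 - a).
have dP (y : R) : 0 < y -> is_derive y 1 P (y `^ (- a)).
  move=> y0; have h := @is_derive1_powR _ (1 - a) y y0.
  rewrite /P; apply: is_derive_eq.
  rewrite /GRing.scale/= mulr0 add0r.
  have -> : 1 - a - 1 = - a by ring.
  by rewrite mulrA mulVf ?mul1r// gt_eqF.
have cp (y : R) : 0 < y -> {for y, continuous (fun y : R => y `^ (- a))}.
  by move=> y0; apply: (is_derive_continuous (is_derive1_powR (- a) y0)).
(* For [k = 0] the interval is the single point [rho], which the fundamental theorem excludes. *)
have [->|kneq0] := eqVneq k 0%N.
  rewrite /F divr1 set_itv1 integral_set1 lee_fin divr_ge0 ?powR_ge0//; exact: ltW.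
have elt : rho / k.+1%:R < rho.
  by rewrite ltr_pdivrMr// ltr_pMr// ltr1n ltnS lt0n.
rewrite /F (@continuous_FTC2 _ (fun y => y `^ (- a)) P)//.
- by rewrite -EFinB lee_fin gerBl divr_ge0 ?powR_ge0//; exact: ltW.
- apply: continuous_in_subspaceT => y /[!inE]/=; rewrite in_itv/= => /andP[y0 _].
  by apply: cp; exact: lt_le_trans (e0 k) y0.
- split.
  + move=> y; rewrite in_itv/= => /andP[y0 _].
    by case: (dP y (lt_trans (e0 k) y0)).
  + by apply: cvg_at_right_filter; exact: (is_derive_continuous (dP _ (e0 k))).
  + by apply: cvg_at_left_filter; exact: (is_derive_continuous (dP _ rho0)).
- move=> y; rewrite in_itv/= => /andP[y0 _].
  have hy := dP y (lt_trans (e0 k) y0).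
  by rewrite derive1E derive_val.
Qed.

(* The value [+oo] at [0] has to be forced, as [0 `^ (- a)] is [0]; it makes the
   products below dominate the time integral also where it diverges. *)
Definition singular_gauss (a k y : R) : \bar R :=
  if y == 0 then +oo%E else (`|y| `^ (- a) * expR (- (k * y ^+ 2)))%:E.

Lemma singular_gauss_gt0 a k y : (0 < singular_gauss a k y)%E.
Proof.
rewrite /singular_gauss; case: ifPn => [_|y0]; first by rewrite ltry.
by rewrite lte_fin mulr_gt0 ?expR_gt0// powR_gt0// normr_gt0.
Qed.

Lemma measurable_powRN_gauss (a k : R) :
  measurable_fun setT (fun y : R => `|y| `^ (- a) * expR (- (k * y ^+ 2))).
Proof.
apply: measurable_funM; last exact: measurable_gauss.
by apply: (measurableT_comp (measurable_powR _)); exact: normr_measurable.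
Qed.

Lemma measurable_singular_gauss a k : measurable_fun setT (singular_gauss a k).
Proof.
apply: measurable_fun_ifT => //; first exact: measurable_fun_eqr.
by apply/measurable_EFinP; exact: measurable_powRN_gauss.
Qed.

(** The line is cut at [|y| = 1/r], the scale of the Gaussian. Inside, the Gaussian is dropped and
    the singularity gives [2 / (1 - a)]; outside, [|y|^(-a) <= r^a] and the Gaussian gives
    [sqrt(pi / c)]. Both carry the factor [r^(a - 1)]. *)
Lemma integral_singular_gauss_le (a c r : R) : 0 < a < 1 -> 0 < c -> 0 < r ->
  (\int[leb]_y singular_gauss a (c * r ^+ 2) y <=
   (r `^ (a - 1) * (2 / (1 - a) + Num.sqrt (pi / c)))%:E)%E.
Proof.
move=> a01 c0 r0; have /andP[a0 a1] := a01; have a1' : 0 < 1 - a by rewrite subr_gt0.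
have k0 : 0 < c * r ^+ 2 by rewrite mulr_gt0// exprn_gt0.
pose g y := `|y| `^ (- a) * expR (- (c * r ^+ 2 * y ^+ 2)).
pose rho := r^-1; have rho0 : 0 < rho by rewrite invr_gt0.
have rhoE : rho = r `^ (- 1) by rewrite powR_inv1 ?(ltW r0).
pose h1 (y : R) := `|y| `^ (- a) * \1_(`[- rho, rho]%classic : set R) y.
pose h2 (y : R) := r `^ a * expR (- (c * r ^+ 2 * y ^+ 2)).
(* The forced value at 0 sits on a null set, so it does not affect the integral. *)
have sg : (\int[leb]_y singular_gauss a (c * r ^+ 2) y = \int[leb]_y (g y)%:E)%E.
  have mD : measurable (setT `\ (0 : R)) by exact: measurableD.
  rewrite -[LHS](@integral_setD1 _ _ 0) ?setTD//; last 2 first.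
  - exact: measurableC.
  - by apply: measurable_funTS; exact: measurable_singular_gauss.
  rewrite -[RHS](@integral_setD1 _ _ 0) ?setTD//; last 2 first.
  - exact: measurableC.
  - apply: measurable_funTS; apply/measurable_EFinP; exact: measurable_powRN_gauss.
  apply: eq_integral => y /set_mem/= /eqP y0.
  by rewrite /singular_gauss (negbTE y0).
have mh1 : measurable_fun setT h1.
  apply: measurable_funM; last exact: measurable_indic.
  by apply: (measurableT_comp (measurable_powR _)); exact: normr_measurable.
have mh2 : measurable_fun setT h2.
  by apply: measurable_funM => //; exact: measurable_gauss.
have h10 y : 0 <= h1 y by rewrite mulr_ge0 ?powR_ge0// indicE.
have h20 y : 0 <= h2 y by rewrite mulr_ge0 ?powR_ge0 ?expR_ge0.
rewrite sg; apply: (@le_trans _ _ (\int[leb]_y ((h1 y)%:E + (h2 y)%:E))%E).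
  apply: le_integral_ge0 => y _; first by rewrite -EFinD lee_fin addr_ge0.
  rewrite -EFinD lee_fin /g.
  have [yr|yr] := leP `|y| rho.
    apply: (@le_trans _ _ (h1 y)); last by rewrite lerDl.
    rewrite /h1 indicE mem_set/=; last by rewrite in_itv/= -ler_norml.
    rewrite ler_wpM2l ?powR_ge0// expR_le1 oppr_le0 mulr_ge0 ?sqr_ge0//.
    exact: ltW.
  apply: (@le_trans _ _ (h2 y)); last by rewrite lerDr.
  rewrite /h2 ler_wpM2r ?expR_ge0//.
  have -> : r `^ a = rho `^ (- a).
    by rewrite rhoE -powRrM mulN1r opprK.
  have y0 : 0 < `|y| := lt_trans rho0 yr.
  rewrite !powRN lef_pV2 ?posrE ?powR_gt0//.
  by apply: ge0_ler_powR; rewrite ?nnegrE ?(ltW a0) ?(ltW rho0) ?(ltW yr)// ltW.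
rewrite ge0_integralD//; last 4 first.
- by move=> y _; rewrite lee_fin.
- exact/measurable_EFinP.
- by move=> y _; rewrite lee_fin.
- exact/measurable_EFinP.
rewrite mulrDr EFinD leeD//; last first.
  under eq_integral do rewrite EFinM.
  rewrite integralZl//; last exact: integrable_gauss.
  rewrite integral_gauss// -EFinM lee_fin.
  have -> : pi / (c * r ^+ 2) = pi / c * r ^- 2.
    by rewrite invfM mulrA.
  rewrite sqrtrM ?divr_ge0 ?pi_ge0 ?(ltW c0)//.
  have -> : Num.sqrt (r ^- 2) = r^-1.
    by rewrite -exprVn sqrtr_sqr ger0_norm// invr_ge0 ltW.
  have -> : r `^ (a - 1) = r `^ a / r.
    rewrite powRB ?powRr1 ?(ltW r0)//.
    by rewrite (gt_eqF r0) implybT.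
  by rewrite mulrA mulrAC.
rewrite ge0_integral_even; last 3 first.
- exact/measurable_EFinP.
- by move=> y; rewrite lee_fin.
- by move=> y; rewrite /h1 normrN !indicE !mem_setE !in_itv/= -!ler_norml normrN.
have -> : (\int[leb]_(y in `[0%R, +oo[) (h1 y)%:E =
    \int[leb]_(y in `]0%R, rho]) (y `^ (- a))%:E)%E.
  rewrite integral_mkcond [RHS]integral_mkcond; apply: eq_integral => y _.
  rewrite !patchE !mem_setE !in_itv/= andbT /h1 indicE mem_setE in_itv/=.
  have [->|y0] := eqVneq y 0.
    by rewrite lexx ltxx normr0 powR0 ?mul0r// oppr_eq0 gt_eqF.
  rewrite le_eqVlt eq_sym (negbTE y0)/=; have [ylt0|] := ltP 0 y; last by [].
  rewrite ger0_norm ?(ltW ylt0)// (le_trans _ (ltW ylt0)) ?oppr_le0 ?(ltW rho0)//=.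
  by case: ifP; rewrite ?mulr1 ?mulr0.
apply: (@le_trans _ _ (2%:E * (rho `^ (1 - a) / (1 - a))%:E)%E).
  by rewrite lee_wpmul2l// integral_powRN_le.
rewrite -EFinM lee_fin /rho.
have -> : r^-1 `^ (1 - a) = r `^ (a - 1).
  by rewrite -/rho rhoE -powRrM mulN1r opprB.
by rewrite mulrCA.
Qed.

(** This is Young's inequality for [y^beta] and 1 with exponents [1/beta] and [1/(1 - beta)]; it
    says that the concave power lies below its tangent at 1. *)
Lemma powR_bernoulli (beta y : R) : 0 < beta < 1 -> 0 <= y ->
  y `^ beta <= beta * y + (1 - beta).
Proof.
move=> /andP[b0 b1] y0; have b1' : 0 < 1 - beta by rewrite subr_gt0.
have := @conjugate_powR _ (y `^ beta) 1 beta^-1 (1 - beta)^-1 (powR_ge0 _ _) ler01.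
rewrite !invr_gt0 !invrK b0 b1' => /(_ isT isT).
rewrite subrKC => /(_ erefl).
rewrite mulr1 powR1 mul1r -powRrM divff ?gt_eqF// powRr1//.
by rewrite [beta * y]mulrC.
Qed.

(** One factor [x + y] is split off the power; the remaining exponent [gamma - 1] is negative, so
    replacing [x + y] by either summand increases the term. *)
Lemma powRD_subadditive (gamma x y : R) : 0 < gamma < 1 -> 0 < x -> 0 < y ->
  (x + y) `^ gamma <= x `^ gamma + y `^ gamma.
Proof.
move=> /andP[g0 g1] x0 y0; have xy0 : 0 < x + y by rewrite addr_gt0.
have H (z : R) : 0 < z -> z <= x + y -> z * (x + y) `^ (gamma - 1) <= z `^ gamma.
  move=> z0 zxy; rewrite -(mulr_powRB1 (ltW z0) g0) ler_wpM2l ?(ltW z0)//.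
  rewrite -opprB !powRN lef_pV2 ?posrE ?powR_gt0//.
  by apply: ge0_ler_powR; rewrite ?nnegrE ?subr_ge0 ?(ltW g1) ?(ltW z0) ?(ltW xy0).
rewrite -(mulr_powRB1 (ltW xy0) g0) mulrDl lerD// H// ?lerDl ?lerDr ltW//.
Qed.

(** By concavity the increment is at least [q] times the slope at the right end,
    [beta (q + M)^(beta - 1)]; this is [powR_bernoulli] at [M / (q + M)]. Subadditivity of the power
    [1 - beta] then separates the regimes of large and small [q]. *)
Lemma powR_increment_inv_le (beta q M : R) : 0 < beta < 1 -> 0 < q -> 0 < M ->
  0 < (q + M) `^ beta - M `^ beta /\
  ((q + M) `^ beta - M `^ beta)^-1 <=
  beta^-1 * (q `^ (- beta) + M `^ (1 - beta) * q `^ (- 1)).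
Proof.
move=> b01 q0 M0; have /andP[b0 b1] := b01.
have qM0 : 0 < q + M by rewrite addr_gt0.
have lb : beta * q * (q + M) `^ (beta - 1) <= (q + M) `^ beta - M `^ beta.
  have := @powR_bernoulli beta (M / (q + M)) b01 (ltW (divr_gt0 M0 qM0)).
  move=> /(ler_wpM2r (powR_ge0 (q + M) beta)).
  rewrite -powRM ?divr_ge0 ?(ltW M0) ?(ltW qM0)// divfK ?gt_eqF//.
  rewrite -(mulr_powRB1 (ltW qM0) b0) => h.
  rewrite -subr_ge0 in h; rewrite -subr_ge0; apply: (le_trans h).
  rewrite le_eqVlt; apply/orP; left; apply/eqP; field.
  by rewrite gt_eqF.
have lb0 : 0 < beta * q * (q + M) `^ (beta - 1) by rewrite !mulr_gt0// powR_gt0.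
split; first exact: lt_le_trans lb.
apply: (@le_trans _ _ (beta * q * (q + M) `^ (beta - 1))^-1).
  by rewrite lef_pV2// posrE// (lt_le_trans lb0).
rewrite -mulrA invfM ler_wpM2l ?invr_ge0 ?(ltW b0)// invfM -powRN opprB.
apply: (@le_trans _ _ (q^-1 * (q `^ (1 - beta) + M `^ (1 - beta)))).
  rewrite ler_wpM2l ?invr_ge0 ?(ltW q0)// powRD_subadditive// subr_gt0 b1/=.
  by rewrite gtrBl.
rewrite mulrDr lerD//.
  rewrite (_ : q `^ (- beta) = q `^ (1 - beta - 1)); last by congr (_ `^ _); ring.
  rewrite [leRHS]powRB; last by rewrite (gt_eqF q0) implybT.
  by rewrite powRr1 ?(ltW q0)// [leLHS]mulrC.
by rewrite powR_inv1 ?(ltW q0)// mulrC.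
Qed.

End singular_integrals.

(** * The resolvent kernel *)

Section resolvent_bound.
Context {R : realType} (n : nat).
Local Notation leb := (@lebesgue_measure R).
Local Notation mu := (lebesgue_rV R n).

Lemma prode_ge0 k (h : 'I_k -> \bar R) :
  (forall i, 0 <= h i)%E -> (0 <= \prod_(i < k) h i)%E.
Proof. by move=> h0; apply: (big_ind (fun x => 0 <= x)%E) => // x y; exact: mule_ge0. Qed.

Lemma prode_singular_eqy (a k : R) (xi : 'rV[R]_n) j : xi ord0 j = 0 ->
  (\prod_(i < n) singular_gauss a k (xi ord0 i) = +oo)%E.
Proof.
move=> xij; rewrite (bigD1 j)//= {1}/singular_gauss xij eqxx gt0_mulye//.
by apply: (big_ind (fun x => 0 < x)%E) => // [x y|i _]; [exact: mule_gt0|exact: singular_gauss_gt0].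
Qed.

(** Each coordinate takes an n-th part of the power, by [|xi|^2 >= xi_i^2]. The factor 2 in the
    exponent appears because [gamma] is a power of the squared norm. *)
Lemma powRN_gauss_le_prode (gamma k : R) (xi : 'rV[R]_n) : (0 < n)%N -> 0 < gamma ->
  (forall i, xi ord0 i != 0) ->
  ((dotv xi xi `^ (- gamma) * expR (- (k * dotv xi xi)))%:E <=
   \prod_(i < n) singular_gauss (2 * gamma / n%:R) k (xi ord0 i))%E.
Proof.
move=> n0 g0 xi0; have nR0 : 0 < n%:R :> R by rewrite ltr0n.
rewrite (eq_bigr (fun i => (`|xi ord0 i| `^ (- (2 * gamma / n%:R)) *
    expR (- (k * xi ord0 i ^+ 2)))%:E)); last first.
  by move=> i _; rewrite /singular_gauss (negbTE (xi0 i)).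
rewrite prodEFin lee_fin big_split /= -expR_sum sumrN -mulr_sumr.
have -> : \sum_(i < n) xi ord0 i ^+ 2 = dotv xi xi.
  by apply: eq_bigr => i _; rewrite expr2.
rewrite ler_wpM2r ?expR_ge0//.
have -> : dotv xi xi `^ (- gamma) = \prod_(i < n) dotv xi xi `^ (- (gamma / n%:R)).
  rewrite big_const_ord iter_mulr_1 -powR_mulrn ?powR_ge0// -powRrM.
  by congr (_ `^ _); field; rewrite gt_eqF.
apply: ler_prod => i _; rewrite powR_ge0/=.
have -> : `|xi ord0 i| `^ (- (2 * gamma / n%:R)) = (xi ord0 i ^+ 2) `^ (- (gamma / n%:R)).
  rewrite -[xi ord0 i ^+ 2]real_normK ?num_real// -powR_mulrn// -powRrM.
  by congr (_ `^ _); ring.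
have s0 : 0 < xi ord0 i ^+ 2 by rewrite lt_neqAle sqr_ge0 andbT eq_sym sqrf_eq0.
have q0 := lt_le_trans s0 (sqr_coord_le_dotvv xi i).
rewrite !powRN lef_pV2 ?posrE ?powR_gt0//.
apply: ge0_ler_powR; rewrite ?nnegrE ?divr_ge0 ?(ltW g0) ?(ltW s0) ?(ltW q0)//.
exact: sqr_coord_le_dotvv.
Qed.

Lemma integral_exp_symbolL_time_le (alpha m k : R) (xi : 'rV[R]_n) :
  (0 < n)%N -> 0 < alpha < 2 -> 0 < m ->
  (\int[leb]_(t in `]0%R, +oo[) (expR (- (t * symbolL alpha m xi)) *
      expR (- (k * dotv xi xi)))%:E <=
   ((alpha / 2)^-1)%:E *
   (\prod_(i < n) singular_gauss (2 * (alpha / 2) / n%:R) k (xi ord0 i) +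
    (m `^ (2 / alpha - 1))%:E *
    \prod_(i < n) singular_gauss (2 * 1 / n%:R) k (xi ord0 i)))%E.
Proof.
move=> n0 /andP[a0 a2] m0.
have b01 : 0 < alpha / 2 < 1 by rewrite divr_gt0//= ltr_pdivrMr// mul1r.
have b0 : 0 < alpha / 2 by case/andP: b01.
have sg0 a i : (0 <= singular_gauss a k (xi ord0 i))%E by rewrite ltW// singular_gauss_gt0.
(* If a coordinate vanishes, the right side is [+oo]. This covers [xi = 0], where the symbol is zero
   and the time integral diverges. *)
have [/existsP[j /eqP xij]|/existsPn xi0] := boolP [exists i, xi ord0 i == 0].
  rewrite (prode_singular_eqy _ _ xij) addye; last first.
    by rewrite gt_eqF// (lt_le_trans (ltNyr 0))// mule_ge0 ?lee_fin ?powR_ge0// prode_ge0.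
  by rewrite gt0_muley ?leey// lte_fin invr_gt0.
have q0 : 0 < dotv xi xi.
  apply: lt_le_trans (sqr_coord_le_dotvv xi (Ordinal n0)).
  by rewrite lt_neqAle sqr_ge0 andbT eq_sym sqrf_eq0; exact: xi0.
have M0 : 0 < m `^ (2 / alpha) by rewrite powR_gt0.
have [psi0 psiV] := powR_increment_inv_le b01 q0 M0.
have psiE := symbolLE xi a0 m0; rewrite -psiE in psi0 psiV.
under eq_integral do rewrite mulrC EFinM.
rewrite ge0_integralZl//; last first.
  apply/measurable_EFinP; apply: measurable_funTS.
  by do 2 apply: measurableT_comp => //; exact: measurable_funM.
apply: (@le_trans _ _ ((expR (- (k * dotv xi xi)))%:E * (symbolL alpha m xi)^-1%:E)%E).
  by rewrite lee_wpmul2l ?lee_fin ?expR_ge0// integral_expN_le.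
have ME : m `^ (2 / alpha) `^ (1 - alpha / 2) = m `^ (2 / alpha - 1).
  by rewrite -powRrM; congr (_ `^ _); field; rewrite gt_eqF.
rewrite ME in psiV.
have P1 := powRN_gauss_le_prode k n0 b0 xi0.
have P2 := powRN_gauss_le_prode k n0 ltr01 xi0.
apply: (@le_trans _ _ (((alpha / 2)^-1)%:E *
    ((dotv xi xi `^ (- (alpha / 2)) * expR (- (k * dotv xi xi)))%:E +
     (m `^ (2 / alpha - 1))%:E *
     (dotv xi xi `^ (- 1) * expR (- (k * dotv xi xi)))%:E))%E).
  rewrite -!EFinM lee_fin.
  have := ler_wpM2l (expR_ge0 (- (k * dotv xi xi))) psiV.
  move=> /le_trans; apply; rewrite le_eqVlt; apply/orP; left; apply/eqP; ring.
rewrite lee_wpmul2l// ?lee_fin ?invr_ge0 ?(ltW b0)//.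
by apply: leeD => //; rewrite lee_wpmul2l// lee_fin powR_ge0.
Qed.

Lemma integral_prode_singular_gauss_le (a c r : R) :
  0 < a < 1 -> 0 < c -> 0 < r ->
  (\int[mu]_xi \prod_(i < n) singular_gauss a (c * r ^+ 2) (xi ord0 i) <=
   (r `^ ((a - 1) * n%:R) * (2 / (1 - a) + Num.sqrt (pi / c)) ^+ n)%:E)%E.
Proof.
move=> a01 c0 r0.
rewrite (@ge0_integral_rV_prod _ _ (fun _ => singular_gauss a (c * r ^+ 2))); last 2 first.
- by move=> i; exact: measurable_singular_gauss.
- by move=> i y; rewrite ltW// singular_gauss_gt0.
have le := integral_singular_gauss_le a01 c0 r0.
have ge : (0 <= \int[leb]_y singular_gauss a (c * r ^+ 2) y)%E.
  by apply: integral_ge0 => y _; rewrite ltW// singular_gauss_gt0.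
have fin : (\int[leb]_y singular_gauss a (c * r ^+ 2) y)%E \is a fin_num.
  by rewrite ge0_fin_numE// (le_lt_trans le)// ltry.
rewrite -(fineK fin) in le ge *; rewrite !lee_fin in le ge.
rewrite prodEFin lee_fin big_const_ord iter_mulr_1 powRrM powR_mulrn ?powR_ge0//.
rewrite -exprMn lerXn2r ?nnegrE// (le_trans ge le)//.
Qed.

Lemma resolvent_kernel_le (alpha m lambda : R) (p : R -> 'rV[R]_n -> R) (x : 'rV[R]_n) :
  (0 < n)%N -> 0 < alpha < 2 -> 0 < m -> is_heat_kernel alpha m p ->
  0 <= lambda -> x != 0 ->
  (resolvent_kernel p lambda x <= ((2 * pi) ^- n)%:E * \int[mu]_xi
    (((alpha / 2)^-1)%:E *
     (\prod_(i < n) singular_gauss (2 * (alpha / 2) / n%:R) (dotv x x / (8 * n%:R)) (xi ord0 i) +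
      (m `^ (2 / alpha - 1))%:E *
      \prod_(i < n) singular_gauss (2 * 1 / n%:R) (dotv x x / (8 * n%:R)) (xi ord0 i))))%E.
Proof.
move=> n0 a02 m0 hk l0 x0; have /andP[a0 a2] := a02.
set k := dotv x x / (8 * n%:R).
have k0 : 0 <= k by rewrite divr_ge0 ?dotvv_ge0// mulr_ge0.
have c0 : 0 <= (2 * pi) ^- n :> R by rewrite invr_ge0 exprn_ge0// mulr_ge0 ?pi_ge0.
pose F (t : R) (xi : 'rV[R]_n) := expR (- (t * symbolL alpha m xi)) * expR (- (k * dotv xi xi)).
have F0 t xi : 0 <= F t xi by rewrite mulr_ge0 ?expR_ge0.
have P0 a (xi : 'rV[R]_n) : (0 <= \prod_(i < n) singular_gauss a k (xi ord0 i))%E.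
  by apply: prode_ge0 => i; rewrite ltW// singular_gauss_gt0.
have W0 (xi : 'rV[R]_n) : (0 <= ((alpha / 2)^-1)%:E *
    (\prod_(i < n) singular_gauss (2 * (alpha / 2) / n%:R) k (xi ord0 i) +
     (m `^ (2 / alpha - 1))%:E *
     \prod_(i < n) singular_gauss (2 * 1 / n%:R) k (xi ord0 i)))%E.
  apply: mule_ge0; first by rewrite lee_fin invr_ge0 divr_ge0// ltW.
  by apply: adde_ge0 => //; apply: mule_ge0; rewrite ?lee_fin ?powR_ge0.
have msym : measurable_fun setT (fun xi : 'rV[R]_n => symbolL alpha m xi).
  under eq_fun do rewrite symbolLE//.
  apply: measurable_funB => //; apply: (measurableT_comp (measurable_powR _)).
  by apply: measurable_funD => //; exact: measurable_dotvv.
pose D : set R := `]0, +oo[%classic.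
have mD : measurable D by exact: measurable_itv.
(* [w] carries the restriction to positive times as an indicator, so that Tonelli applies on the
   full product. It is jointly measurable, whereas [p] itself may not be. *)
pose w (z : g_sigma_algebraType (R.-ocitv.-measurable) * 'rV[R]_n) : \bar R :=
  (\1_D z.1 * ((2 * pi) ^- n * F z.1 z.2))%:E.
have w0 z : (0 <= w z)%E by rewrite lee_fin !mulr_ge0.
have mw : measurable_fun setT w.
  apply/measurable_EFinP; apply: measurable_funM.
    by apply: measurableT_comp => //; exact: measurable_indic.
  apply: measurable_funM => //; apply: measurable_funM.
    apply: measurableT_comp => //; apply: measurableT_comp => //.
    by apply: measurable_funM => //; exact: (measurableT_comp msym).
  exact: (measurableT_comp (measurable_gauss_rV k)).
apply: (@le_trans _ _ (\int[leb]_t \int[mu]_xi w (t, xi))%E).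
  rewrite /resolvent_kernel integral_mkcond; apply: le_integral_ge0 => t _.
    by apply: integral_ge0 => xi _; exact: w0.
  rewrite patchE; case: ifPn => [tD|_]; last by apply: integral_ge0 => xi _; exact: w0.
  have t0 : 0 < t by move: tD; rewrite inE/= in_itv/= andbT.
  have iF : mu.-integrable setT (fun xi => (F t xi)%:E).
    have iS := @integrable_exp_symbolL _ n _ _ _ a0 m0 t0.
    apply: (le_integrable _ _ _ iS) => //.
      apply/measurable_EFinP; apply: measurable_funM; last exact: measurable_gauss_rV.
      by apply/measurable_EFinP; move/measurable_int: iS.
    move=> xi _; rewrite lee_fin normrM ler_piMr// ger0_norm ?expR_ge0//.
    by rewrite expR_le1 oppr_le0 mulr_ge0// dotvv_ge0.
  under eq_integral do rewrite /w /= indicE tD mul1r EFinM.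
  rewrite integralZl// -[X in (_ <= _ * X)%E]fineK; last exact: integrable_fin_num.
  rewrite -EFinM lee_fin.
  have B0 : 0 <= (2 * pi) ^- n * \int[mu]_xi F t xi.
    by rewrite mulr_ge0//; apply: Rintegral_ge0 => xi _.
  apply: (@le_trans _ _ (expR (- (lambda * t)) * ((2 * pi) ^- n * \int[mu]_xi F t xi))).
    by rewrite ler_wpM2l ?expR_ge0// heat_kernel_le.
  by rewrite ler_piMl// expR_le1 oppr_le0 mulr_ge0// ltW.
rewrite fubini_tonelli// -ge0_integralZl//; last first.
  apply: measurable_funeM; apply: emeasurable_funD.
    apply: measurable_fun_prode => i.
    by apply: (measurableT_comp (measurable_singular_gauss _ _)); exact: measurable_coord.
  apply: measurable_funeM; apply: measurable_fun_prode => i.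
  by apply: (measurableT_comp (measurable_singular_gauss _ _)); exact: measurable_coord.
apply: le_integral_ge0 => xi _.
  by apply: mule_ge0; [rewrite lee_fin|exact: W0].
have mF : measurable_fun setT (fun t => (F t xi)%:E).
  apply/measurable_EFinP; apply: measurable_funM => //.
  by do 2 apply: measurableT_comp => //; exact: measurable_funM.
apply: (@le_trans _ _ (((2 * pi) ^- n)%:E * \int[leb]_(t in `]0%R, +oo[) (F t xi)%:E)%E).
  rewrite -ge0_integralZl//; last 2 first.
  - exact: measurable_funTS.
  - by move=> t _; rewrite lee_fin.
  rewrite [leRHS]integral_mkcond; apply: le_integral_ge0 => t _.
    by apply: erestrict_ge0 => s _; rewrite mule_ge0 ?lee_fin.
  rewrite patchE /w /= indicE -/D; case: ifPn => _.
    by rewrite mul1r EFinM.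
  by rewrite mul0r.
by rewrite lee_wpmul2l ?lee_fin// integral_exp_symbolL_time_le.
Qed.

End resolvent_bound.

Theorem proposition6p7 (R : realType) (d : nat) (alpha : R) :
  (3 <= d)%N -> 0 < alpha < 2 ->
  exists C : R, 0 < C /\
    forall (m : R) (p : R -> 'rV[R]_d -> R),
      0 < m -> is_heat_kernel alpha m p ->
      forall (lambda : R) (x : 'rV[R]_d), 0 <= lambda -> x != 0 ->
        (resolvent_kernel p lambda x <=
          (C * (1 / enorm x `^ (d%:R - alpha) +
                m `^ (2 / alpha - 1) / enorm x ^+ (d - 2)))%:E)%E.
Proof.
move=> d3 a02; have /andP[a0 a2] := a02.
have d0 : (0 < d)%N by exact: leq_trans d3.
have dR3 : 3 <= d%:R :> R by rewrite (ler_nat _ 3).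
have dR0 : 0 < d%:R :> R by rewrite ltr0n.
(* [K a] is the one-dimensional constant for [c = 1 / (8 d)] and [r = |x|], because the Gaussian
   rate [|x|^2 / (8 d)] has the form [c r^2]. *)
pose K a : R := 2 / (1 - a) + Num.sqrt (pi / (8 * d%:R)^-1).
(* These are the shares per coordinate of the singularities [|xi|^(-alpha)] and [|xi|^(-2)]. The
   d-th power of [r^(a - 1)] is then [r^(alpha - d)] and [r^(2 - d)] respectively. *)
pose a1 := 2 * (alpha / 2) / d%:R; pose a2' : R := 2 * 1 / d%:R.
have a101 : 0 < a1 < 1.
  by rewrite /a1 !(divr_gt0, mulr_gt0)//= ltr_pdivrMr// mul1r; lra.
have a201 : 0 < a2' < 1.
  by rewrite /a2' !(divr_gt0, mulr_gt0)//= ltr_pdivrMr// mul1r; lra.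
have K0 a : 0 < a < 1 -> 0 < K a.
  by move=> /andP[_ a_lt1]; rewrite ltr_pwDl// divr_gt0// subr_gt0.
have C00 : 0 < (2 * pi) ^- d / (alpha / 2) :> R.
  by rewrite !divr_gt0 ?invr_gt0 ?exprn_gt0 ?mulr_gt0 ?pi_gt0.
exists ((2 * pi) ^- d / (alpha / 2) * (K a1 ^+ d + K a2' ^+ d)); split.
  by rewrite mulr_gt0// addr_gt0// exprn_gt0// K0.
move=> m p m0 hk lambda x l0 x0.
have r0 : 0 < enorm x by rewrite sqrtr_gt0 dotvv_gt0.
have rE : dotv x x / (8 * d%:R) = (8 * d%:R)^-1 * enorm x ^+ 2.
  by rewrite sqr_sqrtr ?dotvv_ge0// mulrC.
have c0 : 0 < (8 * d%:R)^-1 :> R by rewrite invr_gt0 mulr_gt0.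
have mP a : measurable_fun setT (fun xi : 'rV[R]_d =>
    \prod_(i < d) singular_gauss a (dotv x x / (8 * d%:R)) (xi ord0 i))%E.
  apply: measurable_fun_prode => i.
  by apply: (measurableT_comp (measurable_singular_gauss _ _)); exact: measurable_coord.
have P0 a (xi : 'rV[R]_d) :
    (0 <= \prod_(i < d) singular_gauss a (dotv x x / (8 * d%:R)) (xi ord0 i))%E.
  by apply: prode_ge0 => i; rewrite ltW// singular_gauss_gt0.
have M0 : 0 <= m `^ (2 / alpha - 1) by exact: powR_ge0.
have b0 : 0 <= (alpha / 2)^-1 by rewrite invr_ge0 divr_ge0// ltW.
apply: (le_trans (resolvent_kernel_le d0 a02 m0 hk l0 x0)).
rewrite ge0_integralZl//; last 2 first.
- by apply: emeasurable_funD => //; exact: measurable_funeM.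
- by move=> xi _; rewrite adde_ge0// mule_ge0.
rewrite ge0_integralD//; last 2 first.
- by move=> xi _; rewrite mule_ge0.
- exact: measurable_funeM.
rewrite ge0_integralZl//.
have I1 := @integral_prode_singular_gauss_le _ d _ _ _ a101 c0 r0.
have I2 := @integral_prode_singular_gauss_le _ d _ _ _ a201 c0 r0.
rewrite -rE in I1 I2.
have e1 : enorm x `^ ((a1 - 1) * d%:R) = 1 / enorm x `^ (d%:R - alpha).
  rewrite mul1r -powRN opprB /a1; congr (_ `^ _); field; exact: lt0r_neq0.
have e2 : enorm x `^ ((a2' - 1) * d%:R) = (enorm x ^+ (d - 2))^-1.
  rewrite -powR_mulrn ?(ltW r0)// -powRN natrB ?(ltnW d3)// opprB /a2'.
  by congr (_ `^ _); field; exact: lt0r_neq0.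
rewrite e1 -/(K a1) in I1; rewrite e2 -/(K a2') in I2.
apply: (@le_trans _ _ (((2 * pi) ^- d)%:E * (((alpha / 2)^-1)%:E *
    ((1 / enorm x `^ (d%:R - alpha) * K a1 ^+ d)%:E +
     (m `^ (2 / alpha - 1))%:E * ((enorm x ^+ (d - 2))^-1 * K a2' ^+ d)%:E)))%E).
  rewrite lee_wpmul2l ?lee_fin ?invr_ge0 ?exprn_ge0 ?mulr_ge0 ?pi_ge0//.
  rewrite lee_wpmul2l ?lee_fin//.
  by apply: leeD => //; rewrite lee_wpmul2l.
rewrite -!EFinM lee_fin [leLHS]mulrA -[leRHS]mulrA ler_wpM2l ?(ltW C00)//.
(* One constant for both terms is the sum of the two constants; the cross terms that this adds are
   nonnegative. *)
set X := 1 / _; set Y := (enorm x ^+ (d - 2))^-1.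
have X0 : 0 <= X by rewrite divr_ge0 ?powR_ge0.
have Y0 : 0 <= m `^ (2 / alpha - 1) * Y by rewrite mulr_ge0// invr_ge0 exprn_ge0// ltW.
have K1 : 0 <= K a1 ^+ d by rewrite exprn_ge0// ltW// K0.
have K2 : 0 <= K a2' ^+ d by rewrite exprn_ge0// ltW// K0.
nra.
Qed.
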